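(* Let $\pi_\flat$ be an irreducible admissible representation of $\mathrm{SL}_n(D)$ which is $\mathrm{SL}_n^*(E)$-distinguished. Then there exists an irreducible admissible representation $\pi$ of $\mathrm{GL}_n(D)$ which is $\mathrm{GL}_n(E)$-distinguished and satisfies $$\pi_\flat\subset\mathrm{Res}^{\mathrm{GL}_n(D)}_{\mathrm{SL}_n(D)}\,\pi.$$
   Context: $F$ is a finite extension of $\mathbb{Q}_p$, $D$ is a quaternion division algebra over $F$, $E/F$ is a quadratic extension, embedded in $D$ as a maximal subfield, and $n\ge1$. An embedding $\mathrm{GL}_n(E)\subset\mathrm{GL}_n(D)$ is fixed. $\mathcal{N}:M_n(D)\to F$ is the reduced norm, $\mathrm{SL}_n(D)=\{g\in\mathrm{GL}_n(D):\mathcal{N}(g)=1\}$ and $\mathrm{SL}_n^*(E)=\mathrm{GL}_n(E)\cap\mathrm{SL}_n(D)$. Representations are complex. For a subgroup $H$ of a group $G$, a representation $\pi$ of $G$ is $H$-distinguished if $\mathrm{Hom}_H(\pi,\mathbb{1})\neq0$, where $\mathbb{1}$ is the trivial character. *)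

(* Defs.v *)
From HB Require Import structures.
From mathcomp Require Import all_boot all_order all_algebra all_field.
From mathcomp Require Import boolp classical_sets reals.
From mathcomp Require Import complex.

Set Implicit Arguments.
Unset Strict Implicit.
Unset Printing Implicit Defensive.

Import Order.TTheory GRing.Theory Num.Theory.
Local Open Scope classical_set_scope.
Local Open Scope ring_scope.

(* |q|_p, normalised by |p|_p = 1/p. *)
Definition padic_abs (R : realType) (p : nat) (q : rat) : R :=
  if q == 0 then 0
  else p%:R ^- logn p `|numq q|%N * p%:R ^+ logn p `|denq q|%N.

(* (K, abs) is the completion of (rat, |.|_p), that is, K is Q_p with its
   p-adic absolute value. The completion is characterised as a complete valued
   field containing rat isometrically as a dense subfield; this determines it up
   to a unique isometric isomorphism. *)
Record is_Qp (R : realType) (p : nat) (K : fieldType) (abs : K -> R) : Prop :=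
  IsQp {
    Qp_abs_ge0 : forall x, 0 <= abs x;
    Qp_abs_eq0 : forall x, abs x = 0 <-> x = 0;
    Qp_absM : forall x y, abs (x * y) = abs x * abs y;
    Qp_absD : forall x y, abs (x + y) <= abs x + abs y;
    Qp_abs_rat : forall q : rat, abs (ratr q) = padic_abs R p q;
    Qp_dense : forall (x : K) (e : R), 0 < e ->
      exists q : rat, abs (x - ratr q) < e;
    Qp_complete : forall u : nat -> K,
      (forall e : R, 0 < e -> exists N, forall m n,
         (N <= m)%N -> (N <= n)%N -> abs (u m - u n) < e) ->
      exists l : K, forall e : R, 0 < e -> exists N, forall n,
        (N <= n)%N -> abs (u n - l) < e
  }.

Definition quaternion_division_algebra (F : fieldType) (D : falgType F) : Prop :=
  [/\ \dim {:D} = 4%N, 'Z({:D})%VS = 1%VS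
    & forall x : D, x != 0 -> x \is a GRing.unit].

(* The topology of M_n(D). A finite-dimensional vector space over a complete
   valued field has a unique Hausdorff vector space topology, given by the
   sup-norm of the coordinates in any basis; we use the basis vbasis. *)
Definition coord_norm (R : realType) (K : fieldType) (nu : K -> R)
    (V : vectType K) (x : V) : R :=
  \big[Num.max/0]_(i < \dim {:V}) nu (coord (vbasis {:V}) i x).

Definition mx_norm (R : realType) (T : Type) (nu : T -> R) (m n : nat)
    (x : 'M[T]_(m, n)) : R :=
  \big[Num.max/0]_(i < m) \big[Num.max/0]_(j < n) nu (x i j).

Definition mxD_norm (R : realType) (Qp : fieldType) (abs : Qp -> R)
    (F : fieldExtType Qp) (D : falgType F) (n : nat) : 'M[D]_n -> R :=
  mx_norm (coord_norm (coord_norm abs (V := F)) (V := D)) (m := n) (n := n).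

(* 'M_n(A) has no unit ring structure for noncommutative A, hence the explicit
   two-sided inverse. *)
Definition GL (A : nzRingType) (n : nat) : set 'M[A]_n :=
  [set g | exists h, g *m h = 1%:M /\ h *m g = 1%:M].

(* M_n(D) and M_m(A) are F-algebras through scalar matrices; 'M[D]_n only
   carries a D-module structure in the library. *)
Definition scalar_linear (F : fieldType) (A B : lalgType F) (m n : nat)
    (f : 'M[A]_m -> 'M[B]_n) : Prop :=
  forall (a : F) (x : 'M[A]_m), f ((a%:A)%:M *m x) = (a%:A)%:M *m f x.

(* Nrd is the reduced norm of M_n(D), a central simple F-algebra of dimension
   (2n)^2: the determinant after splitting by an extension L of F. Since
   M_n(D) (x) L is simple of dimension (2n)^2 over L, every F-algebra
   homomorphism M_n(D) -> M_2n(L) extends to an isomorphism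
   M_n(D) (x) L = M_2n(L), and the determinant does not depend on the choices. *)
Definition is_reduced_norm (F : fieldType) (D : falgType F) (n : nat)
    (Nrd : 'M[D]_n -> F) : Prop :=
  exists (L : fieldExtType F) (phi : {rmorphism 'M[D]_n -> 'M[L]_(2 * n)}),
    scalar_linear phi /\ forall x, \det (phi x) = (Nrd x)%:A.

Definition SL (F : fieldType) (D : falgType F) (n : nat) (Nrd : 'M[D]_n -> F) :
    set 'M[D]_n :=
  [set g | GL g /\ Nrd g = 1].

(* GL_n(E) is embedded in GL_n(D) by an F-algebra homomorphism
   j : M_n(E) -> M_n(D); by Skolem-Noether every such j is conjugate to the
   entrywise one, map_mx iota, given by an embedding iota of E in D. *)
Definition GLE (F : fieldType) (D : falgType F) (E : fieldExtType F) (n : nat)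
    (j : 'M[E]_n -> 'M[D]_n) : set 'M[D]_n :=
  j @` [set g : 'M[E]_n | g \in unitmx].

Definition SLEstar (F : fieldType) (D : falgType F) (E : fieldExtType F)
    (n : nat) (j : 'M[E]_n -> 'M[D]_n) (Nrd : 'M[D]_n -> F) : set 'M[D]_n :=
  GLE j `&` SL Nrd.

Lemma SL_sub_GL (F : fieldType) (D : falgType F) (n : nat)
  (Nrd : 'M[D]_n -> F) : SL Nrd `<=` @GL D n.
Proof. by move=> g []. Qed.

(* Complex representations of a multiplicative group G contained in a ring A.
   The values of rep_act outside G are irrelevant. *)
Record representation (R : realType) (A : pzRingType) (G : set A) := Rep {
  rep_space : lmodType R[i];
  rep_act : A -> {linear rep_space -> rep_space};
  rep_act1 : forall v, rep_act 1 v = v;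
  rep_actM : forall g h, G g -> G h ->
    forall v, rep_act (g * h) v = rep_act g (rep_act h v)
}.

Definition Res (R : realType) (A : pzRingType) (G H : set A) (sHG : H `<=` G)
    (pi : representation R G) : representation R H :=
  @Rep R A H (rep_space pi) (@rep_act R A G pi) (@rep_act1 R A G pi)
    (fun g h Hg Hh => @rep_actM R A G pi g h (sHG g Hg) (sHG h Hh)).

Definition subrepresentation (R : realType) (A : pzRingType) (G : set A)
    (sigma pi : representation R G) : Prop :=
  exists f : {linear rep_space sigma -> rep_space pi},
    injective f /\
    forall g, G g -> forall v, f (rep_act sigma g v) = rep_act pi g (f v).

Definition invariant_subspace (R : realType) (A : pzRingType) (G : set A)
    (pi : representation R G) (W : set (rep_space pi)) : Prop :=
  [/\ W 0, forall (a : R[i]) u v, W u -> W v -> W (a *: u + v)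
    & forall g, G g -> forall v, W v -> W (rep_act pi g v)].

Definition irreducible_rep (R : realType) (A : pzRingType) (G : set A)
    (pi : representation R G) : Prop :=
  (exists v : rep_space pi, v != 0) /\
  forall W : set (rep_space pi), invariant_subspace W -> W = [set 0] \/ W = setT.

(* Hom_H(pi, 1) <> 0, for a subgroup H of G. *)
Definition distinguished (R : realType) (A : pzRingType) (G : set A)
    (H : set A) (pi : representation R G) : Prop :=
  exists l : {linear rep_space pi -> (R[i])^o},
    (exists v, l v != 0) /\ forall h, H h -> forall v, l (rep_act pi h v) = l v.

(* Openness in G for the subspace topology induced by the norm nrm of A. *)
Definition open_in (R : realType) (A : pzRingType) (nrm : A -> R)
    (G U : set A) : Prop :=
  U `<=` G /\
  forall g, U g -> exists2 e : R, 0 < e & forall h, G h -> nrm (h - g) < e -> U h.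

Definition is_subgroup (A : pzRingType) (G K : set A) : Prop :=
  [/\ K `<=` G, K 1, forall g h, K g -> K h -> K (g * h)
    & forall g, K g -> exists h, [/\ K h, g * h = 1 & h * g = 1]].

Definition stabiliser (R : realType) (A : pzRingType) (G : set A)
    (pi : representation R G) (v : rep_space pi) : set A :=
  [set g | G g /\ rep_act pi g v = v].

Definition fixed_vectors (R : realType) (A : pzRingType) (G : set A)
    (pi : representation R G) (K : set A) : set (rep_space pi) :=
  [set v | forall g, K g -> rep_act pi g v = v].

Definition finite_dim (R : realType) (V : lmodType R[i]) (W : set V) : Prop :=
  exists s : seq V, forall v, W v ->
    exists c : 'I_(size s) -> R[i], v = \sum_(i < size s) c i *: s`_i.

Definition smooth (R : realType) (A : pzRingType) (nrm : A -> R) (G : set A)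
    (pi : representation R G) : Prop :=
  forall v : rep_space pi, open_in nrm G (stabiliser v).

(* As the compact open subgroups form a basis of neighbourhoods of 1 in the
   groups considered, it is the same to ask for finite dimension only when K is
   moreover compact. *)
Definition admissible (R : realType) (A : pzRingType) (nrm : A -> R)
    (G : set A) (pi : representation R G) : Prop :=
  smooth nrm pi /\
  forall K, is_subgroup G K -> open_in nrm G K ->
    finite_dim (fixed_vectors (pi := pi) K).

(* Main.v *)
Require Import Defs.
From HB Require Import structures.
From mathcomp Require Import all_boot all_order all_algebra all_field.
From mathcomp Require Import boolp classical_sets functions reals.
From mathcomp Require Import complex.
From mathcomp Require Import perm ring lra.

(** Write G for GL_n(D), S for SL_n(D), H for GL_n(E) and Z for the scalars
    F^*; Z is contained in H. Let l be a nonzero functional on [pi_flat],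
    invariant under the intersection of H and S.

    The representation [pi] is found among the functions on M_n(D), on which G
    acts by right translation. To v attach the function F_v supported on H S
    with F_v(h s) = l(s v). It is well defined because l is invariant under the
    intersection of H and S; the map v |-> F_v is S-equivariant, and injective
    because [pi_flat] is irreducible; and F_v is left H-invariant, hence fixed by
    the central subgroup Z of H ([exists_model]).

    Let V be the space of the functions F_v, and suppose that G is a finite union
    of cosets t_i Z S. Then the translates of V span a G-invariant space W which
    is the finite sum of the spaces t_i V, each irreducible under S. Such a sum
    has a minimal nonzero G-invariant subspace X, and X has an S-invariant
    complement which is a sum of some of the t_i V ([exists_minimal_subspace]). X is the required
    representation:
    - evaluation at 1 is H-invariant, and it is nonzero on any nonzero space of
      functions on G that is stable under right translations;
    - some t_j V meets the complement trivially, so it embeds in X by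
      projection, and translating back by the inverse of t_j embeds [pi_flat];
    - the vectors of W fixed by an open subgroup are obtained from those of
      finitely many conjugates of [pi_flat], hence form a finite-dimensional
      space; and X is smooth because every element of G close to 1 is the product
      of a scalar and of an element of S close to 1.

    Both topological facts about Z S come from F, as the reduced norm of a scalar
    a is a^m with m = 2n. A fixed-point iteration shows that elements of F close
    to 1 are m-th powers of elements close to 1 ([root_near1]); with the
    continuity of the reduced norm this gives the decomposition near 1
    ([GL_near1]). Combined with the compactness of the unit ball
    ([unit_ball_small]), it shows that F^* modulo m-th powers is finite
    ([finite_power_classes]), hence so is the number of cosets ([GL_cosets]). *)

Set Implicit Arguments.
Unset Strict Implicit.
Unset Printing Implicit Defensive.

Import Order.TTheory GRing.Theory Num.Theory.
Local Open Scope classical_set_scope.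
Local Open Scope ring_scope.

(** * Subspaces and subrepresentations *)

Definition subspace (K : pzRingType) (V : lmodType K) (W : set V) : Prop :=
  W 0 /\ forall (a : K) u v, W u -> W v -> W (a *: u + v).

Section Subspace.
Variables (K : pzRingType) (V : lmodType K) (W : set V) (HW : subspace W).

Lemma subspaceD u v : W u -> W v -> W (u + v).
Proof. by move=> Wu Wv; rewrite -[u]scale1r; apply: HW.2. Qed.

Lemma subspaceZ a u : W u -> W (a *: u).
Proof. by move=> Wu; rewrite -[_ *: _]addr0; apply: HW.2 => //; case: HW. Qed.

Lemma subspaceB u v : W u -> W v -> W (u - v).
Proof.
by move=> Wu Wv; rewrite addrC -scaleN1r; apply: HW.2.
Qed.

Lemma subspace_sum (I : Type) (r : seq I) (P : pred I) (f : I -> V) :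
  (forall i, P i -> W (f i)) -> W (\sum_(i <- r | P i) f i).
Proof. by move=> Wf; apply: big_ind => //; [case: HW | exact: subspaceD]. Qed.

Definition subspace_pred of subspace W : {pred V} := [pred v | `[< W v >]].

Lemma subspace_pred_closed : submod_closed (subspace_pred HW).
Proof.
split; first by apply/asboolP; case: HW.
by move=> a u v /asboolP Wu /asboolP Wv; apply/asboolP/HW.2.
Qed.

HB.instance Definition _ :=
  GRing.isSubmodClosed.Build K V (subspace_pred HW) subspace_pred_closed.

Definition subspace_type := {v : V | v \in subspace_pred HW}.

HB.instance Definition _ := SubType.on subspace_type.
HB.instance Definition _ := Choice.on subspace_type.
HB.instance Definition _ :=
  [SubChoice_isSubLmodule of subspace_type by <:].

Lemma subspace_typeP (x : subspace_type) : W (\val x).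
Proof. exact/asboolP/(valP x). Qed.

Definition to_subspace (v : V) (Wv : W v) : subspace_type :=
  exist _ v (asboolT Wv : v \in subspace_pred HW).

End Subspace.

Section Codomain.
Variables (K : pzRingType) (U V : lmodType K) (W : set V) (HW : subspace W).
Variables (f : {linear U -> V}) (fW : forall u, W (f u)).

Definition corestrict (u : U) : subspace_type HW := to_subspace HW (fW u).

Lemma corestrict_is_linear : linear corestrict.
Proof. by move=> a u v; apply: val_inj; rewrite [RHS]linearP /= linearP. Qed.

HB.instance Definition _ :=
  GRing.isLinear.Build K U (subspace_type HW) *:%R corestrict
    corestrict_is_linear.

End Codomain.

Lemma linear_of (K : pzRingType) (U V : lmodType K) (f : U -> V) :
  linear f -> exists g : {linear U -> V}, forall u, g u = f u.
Proof.
move=> f_lin.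
pose fL := GRing.isLinear.Build K U V *:%R f f_lin.
pose g : {linear U -> V} := HB.pack f fL.
by exists g.
Qed.

Section SubRep.
Variables (R : realType) (A : pzRingType) (G : set A) (pi : representation R G).
Variables (W : set (rep_space pi)) (HW : subspace W).
Hypothesis stW : forall g, G g -> forall v, W v -> W (rep_act pi g v).

(** A representation has an action map for every element of A, but outside G
    it need not preserve W; there it is replaced by 0. *)
Lemma subrep_act_stable (g : A) (x : subspace_type HW) :
  W (if `[< G g >] then rep_act pi g (\val x) else 0).
Proof.
case: asboolP => Gg; last by case: HW.
by apply: stW => //; exact: subspace_typeP.
Qed.

Definition subrep_act (g : A) (x : subspace_type HW) : subspace_type HW :=
  to_subspace HW (subrep_act_stable g x).

Lemma subrep_act_is_linear g : linear (subrep_act g).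
Proof.
move=> a u v; apply: val_inj; rewrite [RHS]linearP /= !linearP.
by case: asboolP => _; rewrite ?linearP ?scaler0 ?addr0.
Qed.

HB.instance Definition _ g :=
  GRing.isLinear.Build _ _ _ *:%R (subrep_act g) (subrep_act_is_linear g).
Hypothesis G1 : G 1.
Hypothesis GM : forall g h, G g -> G h -> G (g * h).

Lemma subrep_act1 v : subrep_act 1 v = v.
Proof. by apply: val_inj; rewrite /= asboolT // rep_act1. Qed.

Lemma subrep_actM g h : G g -> G h ->
  forall v, subrep_act (g * h) v = subrep_act g (subrep_act h v).
Proof.
move=> Gg Gh v; apply: val_inj; rewrite /= !asboolT //; last exact: GM.
by rewrite rep_actM.
Qed.

Definition subrep : representation R G :=
  @Rep R A G (subspace_type HW) subrep_act subrep_act1 subrep_actM.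

Lemma subrep_actE g (x : rep_space subrep) : G g ->
  \val (rep_act subrep g x : subspace_type HW) = rep_act pi g (\val x).
Proof. by move=> Gg; rewrite /= asboolT. Qed.
End SubRep.

(** * Finite dimension *)

Section FiniteDim.
Variable R : realType.

Definition spanned (V : lmodType R[i]) (s : seq V) (v : V) : Prop :=
  exists c : nat -> R[i], v = \sum_(k < size s) c k *: s`_k.

Lemma spanned_cons (V : lmodType R[i]) (a : V) (s : seq V) (v : V) :
  spanned (a :: s) v <-> exists c, spanned s (v - c *: a).
Proof.
split=> [[c ->]|[c [d dE]]].
  exists (c 0%N), (fun k => c k.+1).
  by rewrite /= big_ord_recl /= addrC addrA addNr add0r.
exists (fun k => if k is k'.+1 then d k' else c).
by rewrite /= big_ord_recl /= -dE addrC subrK.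
Qed.

Lemma spannedP (V : lmodType R[i]) (s : seq V) (a : R[i]) (u v : V) :
  spanned s u -> spanned s v -> spanned s (a *: u + v).
Proof.
move=> [c ->] [d ->]; exists (fun k => a * c k + d k).
rewrite scaler_sumr -big_split; apply: eq_bigr => k _.
by rewrite scalerA scalerDl.
Qed.

Lemma finite_dimP (V : lmodType R[i]) (W : set V) :
  finite_dim W <-> exists s, forall v, W v -> spanned s v.
Proof.
split=> -[s sW]; exists s => v /sW [c ->].
  by exists (fun k => odflt 0 (omap c (insub k))); apply: eq_bigr => k _; rewrite valK.
by exists (fun k => c k).
Qed.

Lemma finite_dim_sub (V : lmodType R[i]) (W W' : set V) :
  W `<=` W' -> finite_dim W' -> finite_dim W.
Proof. by move=> sW [s sP]; exists s => v /sW /sP. Qed.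

Lemma finite_dim0 (V : lmodType R[i]) (W : set V) :
  (forall w, W w -> w = 0) -> finite_dim W.
Proof. by move=> W0; exists [::] => v /W0 ->; exists (fun=> 0); rewrite big_ord0. Qed.

Lemma spanned_cat (V : lmodType R[i]) (s t : seq V) (u v : V) :
  spanned s u -> spanned t v -> spanned (s ++ t) (u + v).
Proof.
elim: s u => [|a s IHs] u; first by move=> [c ->] /=; rewrite big_ord0 add0r.
move=> /spanned_cons [c uP] vP; apply/spanned_cons; exists c.
by rewrite addrAC; exact: IHs.
Qed.

Lemma finite_dimD (V : lmodType R[i]) (X Y W : set V) :
    finite_dim X -> finite_dim Y ->
    (forall w, W w -> exists x y, [/\ X x, Y y & w = x + y]) ->
  finite_dim W.
Proof.
move=> /finite_dimP [s sX] /finite_dimP [t tY] WXY; apply/finite_dimP.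
exists (s ++ t) => w /WXY [x [y [/sX xs /tY yt ->]]]; exact: spanned_cat.
Qed.

Lemma finite_dim_image (V V' : lmodType R[i]) (f : {linear V -> V'})
    (X : set V) (Y : set V') :
  finite_dim X -> (forall y, Y y -> exists2 x, X x & f x = y) -> finite_dim Y.
Proof.
move=> /finite_dimP [s sX] YX; apply/finite_dimP.
exists (map f s) => y /YX [x /sX [c ->] <-]; exists c.
rewrite linear_sum size_map; apply: eq_bigr => k _.
by rewrite linearZ (nth_map 0).
Qed.

(** The spanning vectors found in the target need not be in the image of f, so
    they cannot be pulled back; the induction removes them one at a time. *)
Lemma finite_dim_inj (V V' : lmodType R[i]) (f : {linear V -> V'})
    (W : set V) (Y : set V') :
    injective f -> subspace W -> (forall w, W w -> Y (f w)) -> finite_dim Y ->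
  finite_dim W.
Proof.
move=> f_inj HW WY /finite_dimP [s sY].
have {WY sY} : forall w, W w -> spanned s (f w) by move=> w /WY /sY.
elim: s W HW => [|a s IHs] W HW sW.
  apply: finite_dim0 => w /sW [c]; rewrite big_ord0 => fw0.
  by apply: f_inj; rewrite fw0 linear0.
pose W0 := W `&` [set w | spanned s (f w)].
have HW0 : subspace W0.
  split; first by split; [case: HW | exists (fun=> 0); rewrite linear0 big1 // => k _; rewrite scale0r].
  move=> c u v [Wu su] [Wv sv]; split; first exact: HW.2.
  by rewrite /= linearP; exact: spannedP.
have fdW0 : finite_dim W0 by apply: IHs HW0 _ => w [].
have [WW0|] := pselect (W `<=` W0); first exact: finite_dim_sub WW0 fdW0.
move=> /existsNP [w0 /not_implyP [Ww0 nW0]].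
have /spanned_cons [c cw0] := sW _ Ww0.
have c0 : c != 0.
  by apply/eqP => c0; apply: nW0; split=> //=; rewrite -[f w0]subr0 -(scale0r a) -c0.
move: fdW0 => /finite_dimP [t tW0]; apply/finite_dimP; exists (w0 :: t) => w Ww.
have /spanned_cons [d dw] := sW _ Ww.
apply/spanned_cons; exists (d / c); apply: tW0; split.
  by apply: subspaceB => //; exact: subspaceZ.
rewrite /=; have -> : f (w - (d / c) *: w0) = - (d / c) *: (f w0 - c *: a) + (f w - d *: a).
  rewrite linearB linearZ /= scalerBr !scaleNr scalerA divfK // opprK.
  by rewrite [RHS]addrC addrACA addNr addr0.
exact: spannedP.
Qed.

End FiniteDim.

(** * Finite sums of irreducible subspaces *)

Definition nonzero (V : zmodType) (W : set V) : Prop := exists2 w, W w & w != 0.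

Definition meet_trivially (V : zmodType) (X Y : set V) : Prop :=
  forall w, X w -> Y w -> w = 0.

Definition sumset (V : zmodType) (X Y : set V) : set V :=
  [set w | exists x y, [/\ X x, Y y & w = x + y]].

Lemma invariant_subspaceW (R : realType) (A : pzRingType) (S : set A)
    (M : representation R S) (W : set (rep_space M)) :
  invariant_subspace W -> subspace W.
Proof. by case. Qed.

Section FiniteSums.
Variables (R : realType) (A : pzRingType) (S : set A).
Variables (M : representation R S).
Implicit Types W X Y : set (rep_space M).

Definition irreducible_subspace X : Prop :=
  [/\ invariant_subspace X, nonzero X
    & forall W, invariant_subspace W -> W `<=` X -> nonzero W -> X `<=` W].

Lemma invariant_sumset X Y :
  invariant_subspace X -> invariant_subspace Y -> invariant_subspace (sumset X Y).
Proof.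
move=> [X0 XP XS] [Y0 YP YS]; split.
- by exists 0, 0; rewrite addr0.
- move=> a _ _ [x [y [Xx Yy ->]]] [x' [y' [Xx' Yy' ->]]].
  exists (a *: x + x'), (a *: y + y'); split; [exact: XP|exact: YP|].
  by rewrite scalerDr addrACA.
- move=> g Sg _ [x [y [Xx Yy ->]]].
  by exists (rep_act M g x), (rep_act M g y); rewrite linearD; split; auto.
Qed.

Lemma invariant_setI X Y :
  invariant_subspace X -> invariant_subspace Y -> invariant_subspace (X `&` Y).
Proof.
move=> [X0 XP XS] [Y0 YP YS]; split=> //.
  by move=> a u v [? ?] [? ?]; split; auto.
by move=> g Sg v [? ?]; split; auto.
Qed.

Lemma irreducible_sub_or_disjoint X Y :
  irreducible_subspace X -> invariant_subspace Y -> X `<=` Y \/ meet_trivially X Y.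
Proof.
move=> [Xinv _ Xirr] Yinv.
have [XY0|nXY] := pselect (meet_trivially X Y); [by right | left].
have XY : X `<=` X `&` Y.
  apply: Xirr; [exact: invariant_setI | by move=> w [] |].
  move/existsNP: nXY => [w /not_implyP [Xw /not_implyP [Yw /eqP w0]]].
  by exists w.
by move=> w /XY [].
Qed.

Variables (I : finType) (V : I -> set (rep_space M)).
Hypothesis Virr : forall i, irreducible_subspace (V i).

Definition partial_sum (T : {set I}) : set (rep_space M) :=
  [set w | exists f : I -> rep_space M,
     [/\ forall i, V i (f i), forall i, i \notin T -> f i = 0
       & w = \sum_i f i]].

Let Vinv i : invariant_subspace (V i). Proof. by case: (Virr i). Qed.

Lemma invariant_partial_sum T : invariant_subspace (partial_sum T).
Proof.
split.
- exists (fun=> 0); split=> [i||] //; first by case: (Vinv i).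
  by rewrite big1.
- move=> a _ _ [f [fV fT ->]] [f' [fV' fT' ->]].
  exists (fun i => a *: f i + f' i); split.
  + by move=> i; case: (Vinv i) => _ VP _; exact: VP.
  + by move=> i iT; rewrite fT // fT' // scaler0 addr0.
  + by rewrite scaler_sumr big_split.
- move=> g Sg _ [f [fV fT ->]]; exists (fun i => rep_act M g (f i)); split.
  + by move=> i; case: (Vinv i) => _ _; apply.
  + by move=> i iT; rewrite fT // linear0.
  + by rewrite linear_sum.
Qed.

Lemma partial_sum0 w : partial_sum finset.set0 w -> w = 0.
Proof. by move=> [f [_ f0 ->]]; apply: big1 => i _; apply: f0; rewrite inE. Qed.

Lemma sub_partial_sum (T : {set I}) i : i \in T -> V i `<=` partial_sum T.
Proof.
move=> iT v Vv; exists (fun k => if k == i then v else 0); split.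
- by move=> k; case: eqP => [->|_] //; case: (Vinv k).
- by move=> k kT; case: eqP kT => // ->; rewrite iT.
- by rewrite -big_mkcond big_pred1_eq.
Qed.

Lemma partial_sumU1 (T : {set I}) j :
  partial_sum (j |: T) `<=` sumset (V j) (partial_sum T).
Proof.
move=> _ [f [fV fT ->]]; exists (f j), (\sum_(i | i != j) f i).
split=> //; last by rewrite (bigD1 j).
exists (fun i => if i != j then f i else 0); split.
- by move=> i; case: eqP => _ //; case: (Vinv i).
- by move=> i iT; case: eqP => //= /eqP ij; apply: fT; rewrite !inE negb_or ij.
- by rewrite -big_mkcond.
Qed.

Lemma partial_sum_sub X (T : {set I}) :
  invariant_subspace X -> (forall i, i \in T -> V i `<=` X) -> partial_sum T `<=` X.
Proof.
move=> Xinv VX _ [f [fV fT ->]]; apply: subspace_sum => [|i _].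
  exact: invariant_subspaceW.
have [iT|iT] := boolP (i \in T); first exact: VX iT _ (fV i).
by rewrite fT //; case: Xinv.
Qed.

(** A subspace that avoids the partial sum over T but meets the one over
    j |: T has a vector with nonzero component in V j, and then contains V j
    modulo the partial sum over T, because V j is irreducible. *)
Lemma sub_sum_of_not_disjoint X (T : {set I}) j :
    invariant_subspace X -> meet_trivially X (partial_sum T) ->
    ~ meet_trivially X (partial_sum (j |: T)) ->
  V j `<=` sumset X (partial_sum T).
Proof.
move=> Xinv XT /existsNP [x /not_implyP [Xx /not_implyP [xT x0]]].
have Tinv := invariant_partial_sum T.
have XTinv := invariant_sumset Xinv Tinv.
have [//|VXT] := irreducible_sub_or_disjoint (Virr j) XTinv.
have [v [w [Vv Tw xE]]] := partial_sumU1 xT.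
case: x0; apply: XT => //; rewrite xE (_ : v = 0) ?add0r //.
apply: VXT => //; exists x, (-1 *: w); split=> //.
  by apply: subspaceZ => //; exact: invariant_subspaceW.
by rewrite xE scaleN1r addrK.
Qed.

(** Among the pairs (X, T) of a nonzero member X of the class [good] and a set
    T of indices whose partial sum avoids X, take one with T of largest
    cardinality. The partial sum over T is then a common complement of X and of
    every nonzero good subspace of X, so X has no proper one. *)
Lemma exists_minimal_subspace (good : set (set (rep_space M))) W :
    (forall X, good X -> invariant_subspace X) ->
    good W -> nonzero W -> W `<=` partial_sum finset.setT ->
  exists X T, [/\ good X, nonzero X, X `<=` W, meet_trivially X (partial_sum T) &
    (forall Y, good Y -> nonzero Y -> Y `<=` X -> X `<=` Y) /\
    partial_sum finset.setT `<=` sumset X (partial_sum T)].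
Proof.
move=> goodinv goodW W0 Wsum.
pose ok (T : {set I}) := exists X,
  [/\ good X, nonzero X, X `<=` W & meet_trivially X (partial_sum T)].
have ok0 : `[< ok finset.set0 >].
  by apply/asboolP; exists W; split=> // w _ /partial_sum0.
have [T /asboolP [X [goodX X0 XW XT]] Tmax] :=
  @arg_maxnP _ finset.set0 (fun T => `[< ok T >]) (fun T : {set I} => #|T|) ok0.
have complement Y : good Y -> nonzero Y -> Y `<=` X ->
    partial_sum finset.setT `<=` sumset Y (partial_sum T).
  move=> goodY Y0 YX; have Yinv := goodinv Y goodY.
  have YT : meet_trivially Y (partial_sum T) by move=> w /YX; exact: XT.
  have Tinv := invariant_partial_sum T.
  apply: partial_sum_sub => [|j _]; first exact: invariant_sumset.
  have [jT|jT] := boolP (j \in T).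
    move=> v /(sub_partial_sum jT) Tv; exists 0, v; rewrite add0r; split=> //.
    by case: Yinv.
  apply: sub_sum_of_not_disjoint => // YjT.
  have /Tmax : `[< ok (j |: T) >].
    by apply/asboolP; exists Y; split=> // w /YX /XW.
  by rewrite cardsU1 jT /= ltnn.
exists X, T; split=> //; split; last exact: complement.
move=> Y goodY Y0 YX x Xx.
have [y [w [Yy Tw xE]]] := complement Y goodY Y0 YX _ (Wsum _ (XW _ Xx)).
have Xinv := invariant_subspaceW (goodinv X goodX).
have wE : w = x - y by rewrite xE addrAC subrr add0r.
have w0 : w = 0.
  by apply: XT => //; rewrite wE; apply: subspaceB => //; exact: YX.
by rewrite xE w0 addr0.
Qed.

(** The induction adds one index j at a time: V j is either redundant or in
    direct sum with the earlier ones, and then the fixed vectors of the sum are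
    the sums of fixed vectors. *)
Lemma finite_dim_fixed_partial_sum (K : set A) (T : {set I}) :
    K `<=` S ->
    (forall i, finite_dim (V i `&` fixed_vectors (pi := M) K)) ->
  finite_dim (partial_sum T `&` fixed_vectors (pi := M) K).
Proof.
move=> KS fdV; have [m] := ubnP #|T|; elim: m T => // m IHm T.
rewrite ltnS => Tm.
have [->|/finset.set0Pn [j jT]] := eqVneq T finset.set0.
  by apply: finite_dim0 => w [/partial_sum0].
rewrite -(finset.setD1K jT).
have {IHm Tm} IH : finite_dim (partial_sum (T :\ j) `&` fixed_vectors (pi := M) K).
  by apply: IHm; apply: leq_trans Tm; rewrite [in leqRHS](cardsD1 j) jT.
have Winv := invariant_partial_sum (T :\ j).
set W := partial_sum (T :\ j) in IH Winv *.
have [VW|VW] := irreducible_sub_or_disjoint (Virr j) Winv.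
  apply: finite_dim_sub IH => _ [/partial_sumU1 [v [w [Vv Ww ->]]] fixw].
  by split=> //; apply: subspaceD (VW _ Vv) Ww; exact: invariant_subspaceW.
apply: finite_dimD (fdV j) IH _ => _ [/partial_sumU1 [v [w [Vv Ww ->]]] fixw].
have fix_v g : K g -> rep_act M g v = v.
  move=> Kg; apply/eqP; rewrite -subr_eq0; apply/eqP.
  have gvE : rep_act M g v - v = w - rep_act M g w.
    have := fixw g Kg; rewrite linearD => gE; apply/eqP.
    by rewrite subr_eq addrAC eq_sym subr_eq gE addrC.
  apply: VW.
    apply: subspaceB => //; first exact: invariant_subspaceW.
    by case: (Vinv j) => _ _; apply=> //; exact: KS.
  rewrite gvE; apply: subspaceB => //; first exact: invariant_subspaceW.
  by case: Winv => _ _; apply=> //; exact: KS.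
exists v, w; split=> //; split=> // g Kg.
have := fixw g Kg; rewrite linearD fix_v // => /addrI; exact.
Qed.

End FiniteSums.

(** The projection onto X along Y, composed with f. *)
Lemma exists_projection (K : pzRingType) (L M : lmodType K) (X Y : set M)
    (f : {linear L -> M}) :
    subspace X -> subspace Y -> meet_trivially X Y ->
    (forall v, sumset X Y (f v)) ->
  exists g : {linear L -> M}, forall v, X (g v) /\ Y (f v - g v).
Proof.
move=> HX HY XY fXY.
have /choice [g gP] v : exists x, X x /\ Y (f v - x).
  have [x [y [Xx Yy ->]]] := fXY v; exists x; split=> //.
  by rewrite addrAC subrr add0r.
have g_lin : linear g.
  move=> a u v; apply/eqP; rewrite -subr_eq0; apply/eqP; apply: XY.
    apply: subspaceB => //; first exact: (gP _).1.
    exact: HX.2 (gP u).1 (gP v).1.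
  have -> : g (a *: u + v) - (a *: g u + g v)
      = (a *: (f u - g u) + (f v - g v)) - (f (a *: u + v) - g (a *: u + v)).
    rewrite linearP scalerBr opprB [RHS]addrCA; congr (_ + _).
    by rewrite addrACA addrAC subrr add0r opprD.
  apply: subspaceB => //; last exact: (gP _).2.
  exact: HY.2 (gP u).2 (gP v).2.
by have [g' g'E] := linear_of g_lin; exists g' => v; rewrite g'E.
Qed.

(** * Norms on rings *)

(** Sup-norms of coordinates are multiplicative only up to a constant, hence C. *)
Record ring_norm (R : realType) (A : pzRingType) (nu : A -> R) (C : R) : Prop :=
  RingNorm {
    rnorm_ge0 : forall x, 0 <= nu x;
    rnorm0 : nu 0 = 0;
    rnormN : forall x, nu (- x) = nu x;
    rnormD : forall x y, nu (x + y) <= nu x + nu y;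
    rnormM : forall x y, nu (x * y) <= C * nu x * nu y;
    rnorm_gt0 : 0 < C
  }.

Section RingNorm.
Variables (R : realType) (A : pzRingType) (nu : A -> R) (C : R).
Hypothesis nuP : ring_norm nu C.

Lemma rnormB x y : nu (x - y) <= nu x + nu y.
Proof. by rewrite -(rnormN nuP y) (rnormD nuP). Qed.

Lemma rnorm_distC x y : nu (x - y) = nu (y - x).
Proof. by rewrite -(rnormN nuP) opprB. Qed.

Lemma rnorm_mul_small a b e : 0 < e ->
  exists2 d, 0 < d & forall x, nu x < d -> nu (a * x * b) < e.
Proof.
move=> e0; have C0 := rnorm_gt0 nuP.
have a0 := rnorm_ge0 nuP a; have b0 := rnorm_ge0 nuP b.
pose B := C * (C * nu a) * nu b + 1.
have CCab : 0 <= C * (C * nu a) * nu b by do !(apply: mulr_ge0 => //); exact: ltW.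
have B0 : 0 < B by rewrite ltr_pwDr.
exists (e / B) => [|x]; first exact: divr_gt0.
rewrite ltr_pdivlMr // => xd.
apply: le_lt_trans (rnormM nuP _ _) _.
apply: (@le_lt_trans _ _ (C * (C * nu a * nu x) * nu b)).
  by rewrite ler_wpM2r // ler_wpM2l ?(ltW C0) ?(rnormM nuP).
apply: le_lt_trans xd; rewrite /B; have := rnorm_ge0 nuP x; nra.
Qed.

End RingNorm.

(** From y^-1 - 1 = (1 - y) * ((y^-1 - 1) + 1), if C * nu (y - 1) <= 1/2 then
    nu (y^-1 - 1) is at most 2 * C * nu (y - 1) * nu 1. *)
Lemma inv_near1 (R : realType) (F : fieldType) (nu : F -> R) (C : R) :
  ring_norm nu C -> forall e : R, 0 < e -> exists2 d, 0 < d &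
  forall y, nu (y - 1) < d -> nu (y^-1 - 1) < e.
Proof.
move=> nuP e e0; have C0 := rnorm_gt0 nuP; have n0 := rnorm_ge0 nuP 1.
have B0 : 0 < 2 * C * (nu 1 + 1) by rewrite !mulr_gt0 // ltr_wpDl.
pose d := Num.min e (Num.min (2 * C)^-1 (e / (2 * C * (nu 1 + 1)))).
exists d => [|y]; first by rewrite !lt_min e0 invr_gt0 mulr_gt0 //= divr_gt0.
rewrite !lt_min => /and3P[ye]; rewrite -[(2 * C)^-1]div1r !ltr_pdivlMr ?mulr_gt0 // ?ltr_wpDl //.
have [y0 _ _|y0 y2 yB] := eqVneq y 0; first by move: ye; rewrite y0 invr0.
have E : y^-1 - 1 = (1 - y) * ((y^-1 - 1) + 1) by rewrite subrK mulrBl mul1r divff.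
have := rnormM nuP (1 - y) ((y^-1 - 1) + 1); rewrite -E.
have := rnormD nuP (y^-1 - 1) 1; have := rnorm_ge0 nuP (y^-1 - 1).
have := rnorm_ge0 nuP (y - 1); rewrite (rnorm_distC nuP) in y2 yB *.
set w := nu (y^-1 - 1); set z := nu (1 - y) in y2 yB *; set v := nu (y^-1 - 1 + 1).
move=> z0 w0 vw wv.
have : w <= C * z * (w + nu 1) by apply: le_trans wv _; rewrite ler_wpM2l ?mulr_ge0 // ltW.
nra.
Qed.

Lemma common_radius (R : realType) (I : finType) (T : Type) (P : I -> T -> Prop)
    (Q : T -> Prop) (nu : T -> R) :
    (forall i, exists2 d : R, 0 < d & forall x, Q x -> nu x < d -> P i x) ->
  exists2 d : R, 0 < d & forall i x, Q x -> nu x < d -> P i x.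
Proof.
move=> dP; suff [d d0 ed] : exists2 d : R, 0 < d &
    forall i, i \in enum I -> forall x, Q x -> nu x < d -> P i x.
  by exists d => // i; apply: ed; rewrite mem_enum.
elim: (enum I) => [|i r [d d0 IHr]]; first by exists 1.
have [e e0 eP] := dP i; exists (Num.min d e); first by rewrite lt_min d0.
move=> k; rewrite inE => /orP[/eqP ->|kr] x Qx; rewrite lt_min => /andP[xd xe].
  exact: eP.
exact: IHr kr _ Qx xd.
Qed.

(** * Extending a distinguished representation *)

(** In the application Z consists of the scalars. The cosets t i Z S cover G, and
    Z S is open in the strong sense that the S-component of an element close
    to 1 can be taken close to 1. *)
Section Extension.
Variables (R : realType) (A : pzRingType) (nrm : A -> R) (C : R).
Hypothesis nrmP : ring_norm nrm C.
Variables (G S H Z : set A).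
Hypotheses (GP : is_subgroup G G) (SP : is_subgroup G S) (HP : is_subgroup G H).
Hypothesis S_normal : forall g g' s,
  G g -> G g' -> g * g' = 1 -> g' * g = 1 -> S s -> S (g * s * g').
Hypotheses (ZH : Z `<=` H) (Z_central : forall z x, Z z -> z * x = x * z).
Variables (I : finType) (t t' : I -> A).
Hypotheses (Gt : forall i, G (t i)) (Gt' : forall i, G (t' i)).
Hypotheses (tt' : forall i, t i * t' i = 1) (t't : forall i, t' i * t i = 1).
Hypothesis cosets : forall g, G g ->
  exists i z s, [/\ Z z, S s & g = t i * z * s].
Hypothesis ZS_open : forall e : R, 0 < e -> exists2 d, 0 < d &
  forall g, G g -> nrm (g - 1) < d ->
  exists z s, [/\ Z z, S s, g = z * s & nrm (s - 1) < e].
Variables (sSG : S `<=` G) (pi : representation R S).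
Hypotheses (pi_irr : irreducible_rep pi) (pi_adm : admissible nrm pi).
Hypothesis pi_dist : distinguished (H `&` S) pi.

Let GM g h : G g -> G h -> G (g * h). Proof. by case: GP => _ _ + _; apply. Qed.
Let G1 : G 1. Proof. by case: GP. Qed.
Let SM g h : S g -> S h -> S (g * h). Proof. by case: SP => _ _ + _; apply. Qed.
Let S1 : S 1. Proof. by case: SP. Qed.
Let HM g h : H g -> H h -> H (g * h). Proof. by case: HP => _ _ + _; apply. Qed.
Let H1 : H 1. Proof. by case: HP. Qed.
Let St i s : S s -> S (t i * s * t' i). Proof. by move=> Ss; apply: S_normal. Qed.
Let St' i s : S s -> S (t' i * s * t i). Proof. by move=> Ss; apply: S_normal. Qed.

Definition translate (g : A) (f : A -> R[i]^o) : A -> R[i]^o := fun x => f (x * g).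

Lemma translate_is_linear g : linear (translate g).
Proof. by []. Qed.

HB.instance Definition _ g :=
  GRing.isLinear.Build _ _ _ *:%R (translate g) (translate_is_linear g).

Lemma translate1 f : translate 1 f = f.
Proof. by apply/funext => x; rewrite /translate mulr1. Qed.

Lemma translateM g h f : translate (g * h) f = translate g (translate h f).
Proof. by apply/funext => x; rewrite /translate mulrA. Qed.

Definition function_rep : representation R G :=
  @Rep R A G (A -> R[i]^o) translate translate1 (fun g h _ _ => @translateM g h).

(** The model of the representation in the functions that are left invariant
    under H: the function attached to v has the value l (s v) at h * s, and 0
    outside H * S. *)
Lemma exists_model : exists F : {linear rep_space pi -> (A -> R[i]^o)},
  [/\ injective F,
      forall h v x, H h -> F v (h * x) = F v x,
      forall s v, S s -> F (rep_act pi s v) = translate s (F v),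
      forall z v, Z z -> translate z (F v) = F v
    & forall v x, ~ G x -> F v x = 0].
Proof.
have [l [l0 l_inv]] := pi_dist.
have /choice [phi phiP] (x : A) : exists phi : rep_space pi -> R[i]^o,
    [/\ linear phi, forall h s v, H h -> S s -> x = h * s -> phi v = l (rep_act pi s v)
      & ~ (exists h s, [/\ H h, S s & x = h * s]) -> forall v, phi v = 0].
  have [[h [s [Hh Ss xE]]]|nHS] := pselect (exists h s, [/\ H h, S s & x = h * s]).
    exists (fun v => l (rep_act pi s v)); split.
    - by move=> a u v; rewrite !linearP.
    - move=> h1 s1 v Hh1 Ss1 xE1.
      have [_ _ _ /(_ _ Hh1) [k [Hk h1k kh1]]] := HP.
      have [_ _ _ /(_ _ Ss) [r [Sr sr rs]]] := SP.
      (* Two decompositions differ by k * h, which lies in both H and S. *)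
      have s1E : s1 = k * h * s by rewrite -mulrA -xE xE1 mulrA kh1 mul1r.
      have khE : k * h = s1 * r by rewrite s1E -mulrA sr mulr1.
      have Skh : S (k * h) by rewrite khE; exact: SM.
      by rewrite s1E rep_actM // (l_inv (k * h)) //; split=> //; exact: HM.
    - by case; exists h, s.
  exists (fun=> 0); split=> //; first by move=> a u v; rewrite scaler0 addr0.
  by move=> h s v Hh Ss xE; case: nHS; exists h, s.
pose F0 v : A -> R[i]^o := fun x => phi x v.
have F0_lin : linear F0.
  by move=> a u v; apply/funext => x; have [phi_lin _ _] := phiP x; exact: phi_lin.
have [F FE] := linear_of F0_lin.
have FHS h s v : H h -> S s -> F v (h * s) = l (rep_act pi s v).
  move=> Hh Ss; rewrite FE; have [_ phiE _] := phiP (h * s).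
  exact: phiE Hh Ss erefl.
have F_out x v : ~ (exists h s, [/\ H h, S s & x = h * s]) -> F v x = 0.
  by move=> nx; rewrite FE; have [_ _ phi0] := phiP x; exact: phi0 nx v.
have F_left h v x : H h -> F v (h * x) = F v x.
  move=> Hh; have [_ _ _ /(_ _ Hh) [k [Hk hk kh]]] := HP.
  have [[h1 [s [Hh1 Ss ->]]]|nx] := pselect (exists h s, [/\ H h, S s & x = h * s]).
    by rewrite mulrA !FHS //; exact: HM.
  rewrite !F_out // => -[h1 [s [Hh1 Ss hx]]]; apply: nx.
  exists (k * h1), s; split=> //; first exact: HM.
  by rewrite -mulrA -hx mulrA kh mul1r.
exists F; split=> //.
- have Ker_inv : invariant_subspace (pi := pi) [set v | F v = 0].
    split; first exact: linear0.
      by move=> a u v /= Fu Fv; rewrite linearP Fu Fv scaler0 addr0.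
    move=> s Ss v /= Fv; apply/funext => x; apply/eqP; rewrite -[_ == _]/(_ == 0).
    have [[h1 [r [Hh1 Sr ->]]]|nx] := pselect (exists h s, [/\ H h, S s & x = h * s]).
      rewrite FHS // -rep_actM // -(FHS 1) //; last exact: SM.
      by rewrite Fv.
    by rewrite F_out.
  have [KE|KE] := pi_irr.2 _ Ker_inv.
    move=> u v Fuv; apply/eqP; rewrite -subr_eq0; apply/eqP.
    have : [set v | F v = 0] (u - v) by rewrite /= linearB Fuv subrr.
    by rewrite KE.
  have [v lv] := l0; case/eqP: lv.
  have : [set v | F v = 0] v by rewrite KE.
  by move=> /= Fv; rewrite -[v](rep_act1 (r := pi)) -(FHS 1) // Fv.
- move=> s v Ss; apply/funext => x; rewrite /translate.
  have [_ _ _ /(_ _ Ss) [r [Sr sr rs]]] := SP.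
  have [[h1 [s1 [Hh1 Ss1 ->]]]|nx] := pselect (exists h s, [/\ H h, S s & x = h * s]).
    by rewrite -mulrA !FHS // ?rep_actM //; exact: SM.
  rewrite !F_out // => -[h1 [s1 [Hh1 Ss1 xs]]]; apply: nx.
  exists h1, (s1 * r); split=> //; first exact: SM.
  by rewrite mulrA -xs -mulrA sr mulr1.
- move=> z v Zz; apply/funext => x; rewrite /translate -Z_central //.
  by rewrite F_left //; exact: ZH.
- move=> v x nGx; apply: F_out => -[h [s [Hh Ss xE]]]; apply: nGx.
  by rewrite xE; apply: GM; [case: HP => + _ _ _; apply | exact: sSG].
Qed.

Section Model.
Variable F : {linear rep_space pi -> (A -> R[i]^o)}.
Hypotheses (F_inj : injective F) (F_H : forall h v x, H h -> F v (h * x) = F v x).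
Hypothesis F_S : forall s v, S s -> F (rep_act pi s v) = translate s (F v).
Hypothesis F_Z : forall z v, Z z -> translate z (F v) = F v.
Hypothesis F_G : forall v x, ~ G x -> F v x = 0.

Let M : representation R S := Res sSG function_rep.

Definition conjugate (i : I) : set (rep_space M) :=
  [set f | exists v, f = translate (t i) (F v)].

Let t'tK i f : translate (t' i) (translate (t i) f) = f.
Proof. by rewrite -translateM t't translate1. Qed.

Let tt'K i f : translate (t i) (translate (t' i) f) = f.
Proof. by rewrite -translateM tt' translate1. Qed.

Lemma conjugate_act i s v : S s ->
  translate s (translate (t i) (F v)) = translate (t i) (F (rep_act pi (t' i * s * t i) v)).
Proof.
move=> Ss; rewrite F_S; last exact: St'.
by rewrite -!translateM !mulrA tt' mul1r.
Qed.

Lemma act_conjugate i s v : S s ->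
  translate (t i) (F (rep_act pi s v)) = translate (t i * s * t' i) (translate (t i) (F v)).
Proof.
by move=> Ss; rewrite F_S // -!translateM -!mulrA t't mulr1.
Qed.

(** The subspaces of [conjugate i] stable under S are the translates by [t i] of
    those of [pi], since S is normal. *)
Lemma conjugate_irreducible i : irreducible_subspace (conjugate i).
Proof.
have V_inv : invariant_subspace (conjugate i).
  split; first by exists 0; rewrite !linear0.
    move=> a _ _ [u ->] [v ->]; exists (a *: u + v).
    by rewrite !linearP.
  by move=> s Ss _ [v ->]; exists (rep_act pi (t' i * s * t i) v); exact: conjugate_act.
split=> //.
  have [v v0] := pi_irr.1; exists (translate (t i) (F v)); first by exists v.
  apply: contra v0 => /eqP tFv0; apply/eqP; apply: F_inj.
  by rewrite -(t'tK i (F v)) tFv0 !linear0.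
move=> W [W0 WP WS] WV [w Ww w0].
have pull_inv : invariant_subspace (pi := pi) [set v | W (translate (t i) (F v))].
  split; first by rewrite /= !linear0.
    by move=> a u v /= Wu Wv; rewrite !linearP; exact: WP.
  move=> s Ss v /= Wv; rewrite act_conjugate //; apply: WS => //; exact: St.
have [v wE] := WV _ Ww.
have [K0|KT] := pi_irr.2 _ pull_inv.
  have : [set v | W (translate (t i) (F v))] v by rewrite /= -wE.
  by rewrite K0 /= => v0; rewrite wE v0 !linear0 eqxx in w0.
move=> _ [u ->].
by have : [set v | W (translate (t i) (F v))] u by rewrite KT.
Qed.

(** The span of the G-translates of the model. It is a quotient of the
    representation induced from Z S, with Z acting trivially, and working inside
    a space of functions avoids constructing the latter. *)
Definition induced : set (rep_space M) := partial_sum conjugate finset.setT.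

Let induced_subspace : subspace induced.
Proof. exact/invariant_subspaceW/invariant_partial_sum/conjugate_irreducible. Qed.

Lemma induced_invariant : invariant_subspace (pi := function_rep) induced.
Proof.
have [W0 WP] := induced_subspace; split=> // g Gg w [f [fV _ ->]].
rewrite linear_sum; apply: subspace_sum => // i _.
have [v ->] := fV i.
have [k [z [s [Zz Ss giE]]]] := cosets (GM Gg (Gt i)).
apply: (@sub_partial_sum _ _ _ M _ _ conjugate_irreducible _ k); first by rewrite inE.
exists (rep_act pi s v) => /=.
by rewrite -translateM giE -mulrA !translateM -F_S // F_Z.
Qed.

Lemma induced_nonzero : nonzero induced.
Proof.
have [k _] := cosets G1.
have [_ [f Vf f0] _] := conjugate_irreducible k; exists f => //.
by apply: sub_partial_sum Vf; [exact: conjugate_irreducible | rewrite inE].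
Qed.

Lemma induced_left_invariant f h x : induced f -> H h -> f (h * x) = f x.
Proof.
move=> [fi [fV _ ->]] Hh; rewrite !fct_sumE; apply: eq_bigr => i _.
by have [v ->] := fV i; rewrite /translate -mulrA F_H.
Qed.

(** The functions are defined on all of A; that they vanish outside G ensures
    that a nonzero one can be translated, within G, to be nonzero at 1. *)
Lemma induced_out f x : induced f -> ~ G x -> f x = 0.
Proof.
move=> [fi [fV _ ->]] nGx; rewrite fct_sumE; apply: big1 => i _.
have [v ->] := fV i; rewrite /translate F_G // => Gxt; apply: nGx.
by rewrite -[x]mulr1 -(tt' i) mulrA; exact: GM.
Qed.
Lemma induced_smooth f : induced f -> exists2 d : R, 0 < d &
  forall g, G g -> nrm (g - 1) < d -> translate g f = f.
Proof.
move=> [fi [fV _ ->]].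
have [v vE] := choice fV.
have [d d0 dP] : exists2 d : R, 0 < d & forall i s, S s -> nrm (s - 1) < d ->
    translate s (fi i) = fi i.
  apply: common_radius => i.
  have [_ /(_ 1) []] := pi_adm.1 (v i); first by split=> //; exact: rep_act1.
  move=> e e0 eP; have [d d0 dP] := rnorm_mul_small nrmP (t' i) (t i) e0.
  exists d => // s Ss sd; rewrite vE conjugate_act //.
  have [|_ -> //] := eP _ (St' i Ss).
  have -> : t' i * s * t i - 1 = t' i * (s - 1) * t i.
    by rewrite mulrBr mulrBl mulr1 t't.
  exact: dP.
have [e e0 eP] := ZS_open d0; exists e => // g Gg ge.
have [z [s [Zz Ss -> sd]]] := eP g Gg ge.
rewrite linear_sum; apply: eq_bigr => i _ /=.
by rewrite translateM dP // vE -translateM Z_central // translateM F_Z.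
Qed.

(** The fixed vectors of K in the translate by [t i] correspond to the vectors of
    [pi] fixed by a conjugate of K, which is again open. *)
Lemma induced_fixed_finite_dim (K : set A) :
    is_subgroup G K -> open_in nrm G K ->
  finite_dim (induced `&` fixed_vectors (pi := M) (K `&` S)).
Proof.
move=> [KG K1 KM KV] [_ K_open].
apply: finite_dim_fixed_partial_sum => [i|g [] //|i]; first exact: conjugate_irreducible.
pose K' : set A := [set s | S s /\ K (t i * s * t' i)].
have K'P : is_subgroup S K'.
  split.
  - by move=> s [].
  - by split=> //; rewrite mulr1 tt'.
  - move=> g h [Sg Kg] [Sh Kh]; split; first exact: SM.
    have -> : t i * (g * h) * t' i = (t i * g * t' i) * (t i * h * t' i).
      by rewrite !mulrA -[in RHS](mulrA _ (t' i)) t't mulr1.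
    exact: KM.
  - move=> s [Ss Ks]; have [_ _ _ /(_ s Ss) [r [Sr sr rs]]] := SP.
    have [k [Kk _ ks]] := KV _ Ks.
    exists r; split=> //; split=> //.
    suff -> : t i * r * t' i = k by [].
    rewrite -[LHS]mul1r -ks -mulrA [X in k * X](_ : _ = 1) ?mulr1 //.
    by rewrite !mulrA -(mulrA _ (t' i)) t't mulr1 -(mulrA _ s) sr mulr1 tt'.
have K'_open : open_in nrm S K'.
  split; first by move=> s [].
  move=> s [Ss Ks]; have [e e0 eP] := K_open _ Ks.
  have [d d0 dP] := rnorm_mul_small nrmP (t i) (t' i) e0.
  exists d => // r Sr rd; split=> //; apply: eP; first exact/sSG/St.
  by rewrite -mulrBl -mulrBr; exact: dP.
have fdK' := pi_adm.2 K' K'P K'_open.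
have [Fi FiE] : exists Fi : {linear rep_space pi -> (A -> R[i]^o)},
    forall v, Fi v = translate (t i) (F v).
  by apply: linear_of => a u v; rewrite !linearP.
apply: (finite_dim_image (f := Fi)) fdK' _ => _ [[v ->] fixv].
exists v; last exact: FiE.
move=> s [Ss Ks]; apply: F_inj; rewrite -[LHS](t'tK i) -[RHS](t'tK i).
rewrite act_conjugate //; congr (translate _ _).
by apply: fixv; split=> //; exact: St.
Qed.

(** The extension is a minimal nonzero G-invariant subspace X of [induced],
    complemented by the sum over T of the conjugates. *)
Lemma exists_extension_of_model : exists pi' : representation R G,
  [/\ irreducible_rep pi', admissible nrm pi', distinguished H pi'
    & subrepresentation pi (Res sSG pi')].
Proof.
pose good (X : set (rep_space M)) := invariant_subspace (pi := function_rep) X.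
have good_inv X : good X -> invariant_subspace (pi := M) X.
  by move=> [X0 XP XG]; split=> // s Ss; apply: XG; exact: sSG.
have [X [T [goodX X0 XW XT [Xmin WXT]]]] :=
  exists_minimal_subspace conjugate_irreducible good_inv induced_invariant
    induced_nonzero (fun w => id).
have HX : subspace X by case: goodX.
have XG g : G g -> forall v, X v -> X (rep_act function_rep g v).
  by case: goodX => _ _; apply.
pose pi' := subrep (pi := function_rep) HX XG G1 GM.
have pi'E g (x : rep_space pi') : G g ->
    \val (rep_act pi' g x : subspace_type HX) = translate g (\val x).
  exact: subrep_actE.
have valX (x : rep_space pi') : X (\val (x : subspace_type HX)).
  exact: subspace_typeP.
exists pi'; split.
- split.
    have [w Xw w0] := X0; exists (to_subspace HX Xw).
    by apply: contra w0 => /eqP w0; rewrite -[w]/(\val (to_subspace HX Xw)) w0.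
  move=> W [W0 WP WG].
  have [WE|] := pselect (forall w, W w -> w = 0).
    by left; apply/seteqP; split=> [w /WE|w ->].
  move=> /existsNP [w /not_implyP [Ww w0]]; right.
  pose Y : set (rep_space M) := [set f | exists2 x : rep_space pi', W x & \val (x : subspace_type HX) = f].
  have goodY : good Y.
    split; first by exists 0.
      by move=> a _ _ [u Wu <-] [v Wv <-]; exists (a *: u + v); rewrite ?linearP //; exact: WP.
    by move=> g Gg _ [u Wu <-]; exists (rep_act pi' g u); [exact: WG | rewrite pi'E].
  have Y0 : nonzero Y.
    exists (\val (w : subspace_type HX)); first by exists w.
    by apply/eqP => vw0; apply: w0; apply: val_inj.
  have YX : Y `<=` X by move=> _ [u _ <-].
  apply/seteqP; split=> // x _.
  by have [y Wy /val_inj <-] := Xmin Y goodY Y0 YX _ (valX x).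
- split.
    move=> v; split; first by move=> g [].
    move=> g [Gg gv].
    have [e e0 eP] := induced_smooth (XW _ (valX v)).
    have [_ _ _ /(_ g Gg) [k [Gk gk kg]]] := GP.
    (* Near g, h is the product of g and of k * h, which is close to 1. *)
    have [d d0 dP] := rnorm_mul_small nrmP k 1 e0.
    exists d => // h Gh hd; split=> //.
    have hE : h = g * (k * h) by rewrite mulrA gk mul1r.
    have Gkh : G (k * h) by exact: GM.
    rewrite hE rep_actM // (_ : rep_act pi' (k * h) v = v) //.
    apply: val_inj; rewrite pi'E //; apply: eP => //.
    have -> : k * h - 1 = k * (h - g) * 1 by rewrite mulr1 mulrBr kg.
    exact: dP.
  move=> K KP K_open.
  apply: (finite_dim_inj (f := \val) _ _ _ (induced_fixed_finite_dim KP K_open)).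
  + exact: val_inj.
  + split; first by move=> g _; rewrite linear0.
    by move=> a u v fu fv g Kg; rewrite linearP fu // fv.
  + move=> w fw; split; first exact/XW/valX.
    move=> g [Kg Sg]; rewrite -[RHS](congr1 val (fw g Kg)).
    by rewrite pi'E //; exact: sSG.
- have [ev evE] : exists ev : {linear rep_space pi' -> R[i]^o},
      forall x, ev x = \val (x : subspace_type HX) 1.
    by apply: linear_of => a u v; rewrite linearP.
  exists ev; split.
    have [f Xf f0] := X0.
    have [x fx0] : exists x, f x != 0.
      apply: contrapT => nf; case/eqP: f0; apply/funext => x.
      by apply: contrapT => /eqP fx; apply: nf; exists x.
    have Gx : G x.
      by apply: contrapT => nGx; rewrite (induced_out (XW _ Xf) nGx) eqxx in fx0.
    exists (rep_act pi' x (to_subspace HX Xf)).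
    by rewrite evE pi'E // /translate mul1r.
  move=> h Hh v; rewrite !evE pi'E; last by case: HP => + _ _ _; apply.
  by rewrite /translate mul1r -{1}[h]mulr1 (induced_left_invariant _ (XW _ (valX v))).
- have Tinv := invariant_partial_sum conjugate_irreducible T.
  have HT := invariant_subspaceW Tinv.
  have [j VjT] : exists j, meet_trivially (conjugate j) (partial_sum conjugate T).
    apply: contrapT => nj; have [f Xf /eqP f0] := X0; apply: f0; apply: XT => //.
    apply: partial_sum_sub (XW _ Xf) => // j _.
    have [//|Vj] := irreducible_sub_or_disjoint (conjugate_irreducible j) Tinv.
    by case: nj; exists j.
  have [Fj FjE] : exists Fj : {linear rep_space pi -> (A -> R[i]^o)},
      forall v, Fj v = translate (t j) (F v).
    by apply: linear_of => a u v; rewrite !linearP.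
  have VFj v : conjugate j (Fj v) by exists v.
  (* The translate by t j is projected to X along the partial sum over T, and
     then translated back. *)
  have [q qP] : exists q : {linear rep_space pi -> (A -> R[i]^o)},
      forall v, X (q v) /\ partial_sum conjugate T (Fj v - q v).
    apply: exists_projection => // v; apply: WXT.
    by apply: sub_partial_sum (VFj v); [exact: conjugate_irreducible | rewrite inE].
  have X_t' v : X (translate (t' j) (q v)) by apply: (XG) => //; exact: (qP v).1.
  have [q' q'E] : exists q' : {linear rep_space pi -> (A -> R[i]^o)},
      forall v, q' v = translate (t' j) (q v).
    by apply: linear_of => a u v; rewrite !linearP.
  have Xq' v : X (q' v) by rewrite q'E.
  exists (corestrict HX Xq'); split.
    move=> u v /(congr1 val) /=; rewrite !q'E => /(congr1 (translate (t j))).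
    rewrite !tt'K => quv; apply/eqP; rewrite -subr_eq0; apply/eqP.
    apply: F_inj; rewrite -(t'tK j (F _)) -FjE linear0.
    rewrite (_ : Fj (u - v) = 0) ?linear0 //.
    apply: VjT => //; have := (qP (u - v)).2.
    by rewrite [q _]linearB quv subrr subr0.
  move=> s Ss v; apply: val_inj; rewrite pi'E /=; last exact: sSG.
  rewrite !q'E -translateM.
  have Ss' := St j Ss; have Gs' := sSG Ss'.
  suff -> : q (rep_act pi s v) = translate (t j * s * t' j) (q v).
    by rewrite -translateM !mulrA t't mul1r.
  apply/eqP; rewrite -subr_eq0; apply/eqP; apply: XT.
    by apply: subspaceB => //; [exact: (qP _).1 | apply: (XG) => //; exact: (qP v).1].
  have -> : q (rep_act pi s v) - translate (t j * s * t' j) (q v) =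
      translate (t j * s * t' j) (Fj v - q v) - (Fj (rep_act pi s v) - q (rep_act pi s v)).
    by rewrite linearB !FjE act_conjugate // [RHS]addrC opprB addrA subrK.
  apply: subspaceB => //; last exact: (qP _).2.
  by case: Tinv => _ _; apply=> //; exact: (qP v).2.
Qed.

End Model.

Theorem exists_distinguished_extension : exists pi' : representation R G,
  [/\ irreducible_rep pi', admissible nrm pi', distinguished H pi'
    & subrepresentation pi (Res sSG pi')].
Proof.
by have [F [? ? ? ? ?]] := exists_model; apply: (@exists_extension_of_model F).
Qed.

End Extension.

(** * Sup-norms of coordinates and of matrices *)

Section RingNormSum.
Variables (R : realType) (A : pzRingType) (nu : A -> R) (C : R).
Hypothesis nuP : ring_norm nu C.

Lemma rnorm_sum (I : Type) (r : seq I) (P : pred I) (f : I -> A) :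
  nu (\sum_(i <- r | P i) f i) <= \sum_(i <- r | P i) nu (f i).
Proof.
elim/big_rec2: _ => [|i y x _ le_xy]; first by rewrite (rnorm0 nuP).
by apply: le_trans (rnormD nuP _ _) _; rewrite lerD2l.
Qed.

End RingNormSum.

Definition complete (R : realType) (V : zmodType) (nu : V -> R) : Prop :=
  forall u : nat -> V,
    (forall e : R, 0 < e -> exists N, forall m n,
       (N <= m)%N -> (N <= n)%N -> nu (u m - u n) < e) ->
  exists l : V, forall e : R, 0 < e -> exists N, forall n,
    (N <= n)%N -> nu (u n - l) < e.

Section CoordNorm.
Variables (R : realType) (K : fieldType) (nu : K -> R) (C : R).
Hypothesis nuP : ring_norm nu C.

Section Vect.
Variable V : vectType K.
Local Notation N := (coord_norm nu (V := V)).
Local Notation e := (vbasis {:V}).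

Lemma coord_norm_ge0 x : 0 <= N x.
Proof. exact: bigmax_ge_id. Qed.

Lemma coord_le_norm i x : nu (coord e i x) <= N x.
Proof. exact: le_bigmax. Qed.

Lemma coord_norm_le x B :
  0 <= B -> (forall i, nu (coord e i x) <= B) -> N x <= B.
Proof. by move=> B0 xB; apply: bigmax_le. Qed.

Lemma coord_norm_lt x B :
  0 < B -> (forall i, nu (coord e i x) < B) -> N x < B.
Proof. by move=> B0 xB; apply: bigmax_lt. Qed.

Lemma coord_norm0 : N 0 = 0.
Proof.
apply/eqP; rewrite eq_le coord_norm_ge0 andbT.
by apply: coord_norm_le => // i; rewrite linear0 (rnorm0 nuP).
Qed.

Lemma coord_normN x : N (- x) = N x.
Proof. by apply: eq_bigr => i _; rewrite linearN (rnormN nuP). Qed.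

Lemma coord_normD x y : N (x + y) <= N x + N y.
Proof.
apply: coord_norm_le => [|i]; first by rewrite addr_ge0 ?coord_norm_ge0.
rewrite linearD; apply: le_trans (rnormD nuP _ _) _.
by rewrite lerD ?coord_le_norm.
Qed.

Lemma coord_norm_sum (I : Type) (r : seq I) (P : pred I) (f : I -> V) :
  N (\sum_(i <- r | P i) f i) <= \sum_(i <- r | P i) N (f i).
Proof.
elim/big_rec2: _ => [|i y x _ le_xy]; first by rewrite coord_norm0.
by apply: le_trans (coord_normD _ _) _; rewrite lerD2l.
Qed.

Lemma coord_normZ a x : N (a *: x) <= C * nu a * N x.
Proof.
have C0 := rnorm_gt0 nuP; have a0 := rnorm_ge0 nuP a.
apply: coord_norm_le => [|i]; first by rewrite !mulr_ge0 ?coord_norm_ge0 // ltW.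
rewrite linearZ; apply: le_trans (rnormM nuP _ _) _.
by rewrite ler_wpM2l ?coord_le_norm // mulr_ge0 // ltW.
Qed.

Lemma coord_expand x : x = \sum_i coord e i x *: e`_i.
Proof. exact/coord_vbasis/memvf. Qed.

Lemma coord_norm_eq0 x : (forall a, nu a = 0 -> a = 0) -> N x = 0 -> x = 0.
Proof.
move=> nu0 x0; rewrite [x]coord_expand big1 // => i _.
rewrite (nu0 (coord e i x)) ?scale0r //; apply/eqP.
by rewrite eq_le (rnorm_ge0 nuP) andbT -x0 coord_le_norm.
Qed.

Lemma coord_norm_complete : complete nu -> complete N.
Proof.
move=> nu_complete u u_cauchy.
have /choice [l lP] i : exists l, forall d : R, 0 < d -> exists n0, forall n,
    (n0 <= n)%N -> nu (coord e i (u n) - l) < d.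
  apply: nu_complete => d d0; have [n0 nP] := u_cauchy d d0.
  exists n0 => m n n0m n0n; rewrite -linearB.
  exact: le_lt_trans (coord_le_norm _ _) (nP m n n0m n0n).
exists (\sum_i l i *: e`_i) => d d0.
have /choice [n0 nP] i := lP i d d0.
exists (\max_i n0 i) => n n0n; apply: coord_norm_lt => // i.
rewrite linearB /= coord_sum_free ?(basis_free (vbasisP _)) //.
by apply: nP; apply: leq_trans n0n; exact: leq_bigmax.
Qed.

End Vect.

(** Multiplication is bilinear, so it is bounded by its values on the products
    of basis vectors. *)
Lemma coord_norm_ring (V : falgType K) :
  exists C', ring_norm (coord_norm nu (V := V)) C'.
Proof.
have C0 := rnorm_gt0 nuP.
pose e := vbasis {:V}; set N := coord_norm nu (V := V).
have N0 := @coord_norm_ge0 V.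
pose C' := \sum_(i < \dim {:V}) \sum_(j < \dim {:V}) C * C * N (e`_i * e`_j).
have C'0 : 0 <= C'.
  by do 2!(apply: sumr_ge0 => ? _); rewrite !mulr_ge0 // ltW.
exists (C' + 1); split=> //; [exact: coord_norm0|exact: coord_normN|exact: coord_normD| |].
  move=> x y; apply: (@le_trans _ _ (C' * N x * N y)); last first.
    by rewrite -!mulrA ler_wpM2r ?mulr_ge0 // lerDl.
  rewrite {1}[x]coord_expand mulr_suml; apply: le_trans (coord_norm_sum _ _ _) _.
  rewrite -mulrA mulr_suml; apply: ler_sum => i _.
  rewrite {1}[y]coord_expand mulr_sumr; apply: le_trans (coord_norm_sum _ _ _) _.
  rewrite mulr_suml; apply: ler_sum => j _.
  rewrite -scalerAl -scalerAr.
  have xi := coord_le_norm i x; have yj := coord_le_norm j y.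
  have xi0 := rnorm_ge0 nuP (coord e i x); have yj0 := rnorm_ge0 nuP (coord e j y).
  apply: le_trans (coord_normZ _ _) _.
  apply: (@le_trans _ _ (C * nu (coord e i x) * (C * nu (coord e j y) * N (e`_i * e`_j)))).
    by rewrite ler_wpM2l ?coord_normZ // mulr_ge0 // ltW.
  have -> : C * C * N (e`_i * e`_j) * (N x * N y) = C * N x * (C * N y * N (e`_i * e`_j)) by ring.
  by rewrite ler_pM ?mulr_ge0 ?ler_wpM2r ?ler_wpM2l // ltW.
by rewrite ltr_pwDr.
Qed.

End CoordNorm.

Section MxNorm.
Variables (R : realType) (A : pzRingType) (nu : A -> R) (C : R).
Hypothesis nuP : ring_norm nu C.

Lemma mx_le_norm m n (x : 'M[A]_(m, n)) i j : nu (x i j) <= mx_norm nu x.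
Proof.
apply: (le_trans (le_bigmax _ (fun j => nu (x i j)) j)).
exact: (le_bigmax _ (fun i => \big[Num.max/0]_j nu (x i j)) i).
Qed.

Lemma mx_norm_ge0 m n (x : 'M[A]_(m, n)) : 0 <= mx_norm nu x.
Proof. exact: bigmax_ge_id. Qed.

Lemma mx_norm_le m n (x : 'M[A]_(m, n)) B :
  0 <= B -> (forall i j, nu (x i j) <= B) -> mx_norm nu x <= B.
Proof. by move=> B0 xB; apply: bigmax_le => // i _; apply: bigmax_le. Qed.

Lemma mx_norm_ring n : ring_norm (mx_norm nu (m := n) (n := n)) (n%:R * C + 1).
Proof.
have C0 := rnorm_gt0 nuP; have nu0 := rnorm_ge0 nuP.
have nC0 : 0 <= n%:R * C by rewrite mulr_ge0 // ltW.
split.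
- by move=> x; exact: mx_norm_ge0.
- apply/eqP; rewrite eq_le mx_norm_ge0 andbT.
  by apply: mx_norm_le => // i j; rewrite mxE (rnorm0 nuP).
- by move=> x; apply: eq_bigr => i _; apply: eq_bigr => j _; rewrite mxE (rnormN nuP).
- move=> x y; apply: mx_norm_le => [|i j]; first by rewrite addr_ge0 ?mx_norm_ge0.
  by rewrite mxE; apply: le_trans (rnormD nuP _ _) _; rewrite lerD ?mx_le_norm.
- move=> x y; have x0 := mx_norm_ge0 x; have y0 := mx_norm_ge0 y.
  apply: (@le_trans _ _ (n%:R * C * mx_norm nu x * mx_norm nu y)); last first.
    by rewrite -[leLHS]mulrA -[leRHS]mulrA ler_wpM2r ?mulr_ge0 // lerDl.
  apply: mx_norm_le => [|i j]; first by rewrite !mulr_ge0 // ltW.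
  rewrite mxE; apply: le_trans (rnorm_sum nuP _ _ _) _.
  apply: (@le_trans _ _ (\sum_(k < n) C * mx_norm nu x * mx_norm nu y)).
    apply: ler_sum => k _; apply: le_trans (rnormM nuP _ _) _.
    by rewrite ler_pM ?mulr_ge0 ?ler_wpM2l ?mx_le_norm // ltW.
  by rewrite sumr_const card_ord -[leLHS]mulr_natl !mulrA.
- by rewrite ltr_pwDr.
Qed.

End MxNorm.

(** * Limits and geometric sequences *)

Definition tendsto (R : realType) (T : Type) (rho : T -> R) (A : pzRingType)
    (nu : A -> R) (f : T -> A) (l : A) : Prop :=
  forall e : R, 0 < e -> exists2 d, 0 < d & forall x, rho x < d -> nu (f x - l) < e.

Section Tendsto.
Variables (R : realType) (T : Type) (rho : T -> R).
Variables (A : pzRingType) (nu : A -> R) (C : R).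
Hypothesis nuP : ring_norm nu C.
Implicit Types f g : T -> A.

Lemma tendsto_cst l : tendsto rho nu (fun=> l) l.
Proof. by move=> e e0; exists 1 => // x _; rewrite subrr (rnorm0 nuP). Qed.

Lemma tendsto_ext f g l : f =1 g -> tendsto rho nu f l -> tendsto rho nu g l.
Proof. by move=> /funext ->. Qed.

Lemma tendsto2 f g l k : tendsto rho nu f l -> tendsto rho nu g k ->
  forall e : R, 0 < e -> exists2 d, 0 < d &
  forall x, rho x < d -> nu (f x - l) < e /\ nu (g x - k) < e.
Proof.
move=> fl gk e e0; have [d d0 dP] := fl e e0; have [d' d'0 d'P] := gk e e0.
exists (Num.min d d') => [|x]; first by rewrite lt_min d0.
by rewrite lt_min => /andP[/dP ? /d'P ?].
Qed.

Lemma tendstoD f g l k : tendsto rho nu f l -> tendsto rho nu g k ->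
  tendsto rho nu (fun x => f x + g x) (l + k).
Proof.
move=> fl gk e e0; have e20 : 0 < e / 2 by rewrite divr_gt0.
have [d d0 dP] := tendsto2 fl gk e20; exists d => // x /dP [fe ge].
rewrite opprD addrACA; apply: le_lt_trans (rnormD nuP _ _) _; lra.
Qed.

Lemma tendstoM f g l k : tendsto rho nu f l -> tendsto rho nu g k ->
  tendsto rho nu (fun x => f x * g x) (l * k).
Proof.
move=> fl gk e e0; have C0 := rnorm_gt0 nuP.
have l0 := rnorm_ge0 nuP l; have k0 := rnorm_ge0 nuP k.
pose B := C * (1 + nu l + nu k).
have B0 : 0 < B by rewrite mulr_gt0 //; lra.
pose e' := Num.min 1 (e / B).
have e'0 : 0 < e' by rewrite lt_min ltr01 divr_gt0.
have [d d0 dP] := tendsto2 fl gk e'0; exists d => // x /dP [].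
have -> : f x * g x - l * k =
    (f x - l) * (g x - k) + ((f x - l) * k + l * (g x - k)).
  by rewrite mulrBr addrA subrK mulrBl mulrBr addrA subrK.
set a := f x - l; set b := g x - k => ae be.
have a0 := rnorm_ge0 nuP a; have b0 := rnorm_ge0 nuP b.
have e'1 : e' <= 1 by rewrite ge_min lexx.
have e'B : e' * B <= e by rewrite -ler_pdivlMr // ge_min lexx orbT.
apply: le_lt_trans (rnormD nuP _ _) _.
apply: le_lt_trans (lerD (rnormM nuP _ _) (rnormD nuP _ _)) _.
apply: le_lt_trans (lerD (lexx _) (lerD (rnormM nuP _ _) (rnormM nuP _ _))) _.
apply: lt_le_trans e'B.
have ab : C * nu a * nu b < C * e'.
  by rewrite -mulrA ltr_pM2l // (le_lt_trans _ ae) // ler_piMr // ltW // (lt_le_trans be).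
have ak : C * nu a * nu k <= C * e' * nu k.
  by rewrite ler_wpM2r // ler_wpM2l // ltW.
have lb : C * nu l * nu b <= C * nu l * e'.
  by rewrite ler_wpM2l ?mulr_ge0 // ltW.
rewrite /B; lra.
Qed.

Lemma tendsto_sum (I : Type) (r : seq I) (P : pred I) (f : I -> T -> A) (l : I -> A) :
  (forall i, P i -> tendsto rho nu (f i) (l i)) ->
  tendsto rho nu (fun x => \sum_(i <- r | P i) f i x) (\sum_(i <- r | P i) l i).
Proof.
move=> fl; elim: r => [|i r IHr].
  by apply: tendsto_ext (tendsto_cst _) => x; rewrite !big_nil.
rewrite big_cons; apply: tendsto_ext (_ : tendsto _ _ (fun x => if P i then f i x + _ else _) _).
  by move=> x; rewrite big_cons.
by case: ifP => // Pi; exact: tendstoD (fl i Pi) IHr.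
Qed.

Lemma tendsto_prod (I : Type) (r : seq I) (P : pred I) (f : I -> T -> A) (l : I -> A) :
  (forall i, P i -> tendsto rho nu (f i) (l i)) ->
  tendsto rho nu (fun x => \prod_(i <- r | P i) f i x) (\prod_(i <- r | P i) l i).
Proof.
move=> fl; elim: r => [|i r IHr].
  by apply: tendsto_ext (tendsto_cst _) => x; rewrite !big_nil.
rewrite big_cons; apply: tendsto_ext (_ : tendsto _ _ (fun x => if P i then f i x * _ else _) _).
  by move=> x; rewrite big_cons.
by case: ifP => // Pi; exact: tendstoM (fl i Pi) IHr.
Qed.

Lemma tendstoX f l n : tendsto rho nu f l -> tendsto rho nu (fun x => f x ^+ n) (l ^+ n).
Proof.
move=> fl; elim: n => [|n IHn]; first exact: tendsto_cst.
by rewrite exprS; apply: tendsto_ext (tendstoM fl IHn) => x; rewrite exprS.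
Qed.

End Tendsto.

Section Geometric.
Variable R : realType.

Lemma pow2_gt (B : R) : exists n, B < 2 ^+ n.
Proof.
exists (Num.bound `|B|); apply: le_lt_trans (ler_norm B) _.
apply: lt_le_trans (archi_boundP (normr_ge0 _)) _.
by rewrite -natrX ler_nat ltnW // ltn_expl.
Qed.

Lemma pow2_small (B e : R) : 0 < e -> exists n, B * 2 ^- n < e.
Proof.
move=> e0; have [n nP] := pow2_gt (B / e); exists n.
by rewrite ltr_pdivrMr ?exprn_gt0 // mulrC -ltr_pdivrMr.
Qed.

Variables (A : pzRingType) (nu : A -> R) (C : R).
Hypotheses (nuP : ring_norm nu C) (nu_complete : complete nu).

Lemma geometric_dist (u : nat -> A) (B : R) n k :
    (forall n, nu (u n.+1 - u n) <= B * 2 ^- n) ->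
  nu (u (n + k)%N - u n) <= 2 * B * (2 ^- n - 2 ^- (n + k)).
Proof.
move=> uB; elim: k => [|k IHk]; first by rewrite addn0 !subrr (rnorm0 nuP) mulr0.
have -> : u (n + k.+1)%N - u n = (u (n + k).+1 - u (n + k)%N) + (u (n + k)%N - u n).
  by rewrite addnS addrA subrK.
apply: le_trans (rnormD nuP _ _) _; apply: le_trans (lerD (uB _) IHk) _.
rewrite addnS [2 ^+ (n + k).+1]exprS invfM; lra.
Qed.

Lemma geometric_limit (u : nat -> A) (B : R) :
    0 <= B -> (forall n, nu (u n.+1 - u n) <= B * 2 ^- n) ->
  exists l, forall n, nu (u n - l) <= 2 * B * 2 ^- n.
Proof.
move=> B0 uB.
have dist n m : (n <= m)%N -> nu (u m - u n) <= 2 * B * 2 ^- n.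
  move=> /subnKC <-; apply: le_trans (geometric_dist n _ uB) _.
  by rewrite ler_wpM2l ?mulr_ge0 // gerBl invr_ge0 exprn_ge0.
have [|l lP] := nu_complete (u := u).
  move=> e e0; have [n nP] := pow2_small (4 * B) e0.
  exists n => i j ni nj.
  have -> : u i - u j = (u i - u n) - (u j - u n) by rewrite opprB addrA subrK.
  apply: le_lt_trans (rnormB nuP _ _) _.
  by have := dist n i ni; have := dist n j nj; lra.
exists l => n; apply/ler_addgt0Pr => e e0.
have [m mP] := lP e e0.
have -> : u n - l = (u (maxn n m) - l) - (u (maxn n m) - u n).
  by rewrite opprB [RHS]addrC addrA subrK.
apply: le_trans (rnormB nuP _ _) _; rewrite addrC lerD ?dist ?leq_maxl //.
by rewrite ltW // mP // leq_maxr.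
Qed.

End Geometric.

(** * The p-adic absolute value *)

Section Padic.
Variables (R : realType) (p : nat) (p_prime : prime p).
Variables (Qp : fieldType) (abs : Qp -> R) (QpP : is_Qp p abs).

Let p_gt1 : 1 < p%:R :> R. Proof. by rewrite ltr1n prime_gt1. Qed.
Let p_gt0 : 0 < p%:R :> R. Proof. exact: lt_trans p_gt1. Qed.

Lemma Qp_abs_int (z : int) : z != 0 -> abs z%:~R = p%:R ^- logn p `|z|%N.
Proof.
move=> z0; rewrite -ratr_int (Qp_abs_rat QpP) /padic_abs intr_eq0 (negbTE z0).
by rewrite numq_int denq_int logn1 expr0 mulr1.
Qed.

Lemma Qp_abs_ring : ring_norm abs 1.
Proof.
have abs0 : abs 0 = 0 by apply/(Qp_abs_eq0 QpP).
split=> //; first exact: Qp_abs_ge0 QpP.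
- move=> x; rewrite -mulN1r (Qp_absM QpP) -(mulrN1z 1) Qp_abs_int //.
  by rewrite logn1 expr0 invr1 mul1r.
- exact: Qp_absD QpP.
- by move=> x y; rewrite (Qp_absM QpP) mul1r.
Qed.

Lemma Qp_abs_int_le1 (z : int) : abs z%:~R <= 1.
Proof.
have [->|z0] := eqVneq z 0; first by rewrite (rnorm0 Qp_abs_ring).
by rewrite Qp_abs_int // invf_le1 ?exprn_gt0 // exprn_ege1 // ltW.
Qed.

Lemma Qp_abs_nat_le1 n : abs n%:R <= 1.
Proof. exact: (Qp_abs_int_le1 n). Qed.

Lemma Qp_abs_coprime (z : int) : coprime p `|z| -> abs z%:~R = 1.
Proof.
move=> pz; rewrite Qp_abs_int ?logn_coprime ?expr0 ?invr1 //.
by apply: contraTneq pz => ->; rewrite /coprime gcdn0 neq_ltn prime_gt1 ?orbT.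
Qed.

Lemma Qp_abs_p : abs p%:R = p%:R^-1.
Proof.
rewrite -[p%:R]/(p%:~R) Qp_abs_int; last by rewrite eqz_nat -lt0n prime_gt0.
by rewrite absz_nat logn_prime // eqxx expr1.
Qed.

Lemma Qp_absX x n : abs (x ^+ n) = abs x ^+ n.
Proof.
elim: n => [|n IHn]; last by rewrite !exprS (Qp_absM QpP) IHn.
by rewrite !expr0 (Qp_abs_int (z := 1)) // logn1 invr1.
Qed.

Lemma Qp_nat_neq0 n : (0 < n)%N -> n%:R != 0 :> Qp.
Proof.
move=> n0; apply/eqP => /(Qp_abs_eq0 QpP).
rewrite -[n%:R]/(n%:~R) Qp_abs_int; last by rewrite eqz_nat -lt0n.
by apply/eqP; rewrite gt_eqF // invr_gt0 exprn_gt0.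
Qed.

(** The digit is read off a rational approximation of x to within p^-2. Taking
    residues modulo p^2 rather than p leaves room for the approximation error,
    so that the triangle inequality is enough. *)
Lemma Qp_digit x : abs x <= 1 -> exists c : 'I_(p ^ 2), abs (x - c%:R) <= p%:R^-1.
Proof.
move=> x1; have p2 : 2 <= p%:R :> R by rewrite ler_nat prime_gt1.
have pp0 : 0 < p%:R ^- 2 :> R by rewrite invr_gt0 exprn_gt0.
have [q xq] := Qp_dense QpP x pp0.
have pV : p%:R^-1 <= 1 / 2 :> R by rewrite div1r lef_pV2 ?posrE.
have pV0 : 0 < p%:R^-1 :> R by rewrite invr_gt0.
have ppE : p%:R ^- 2 = p%:R^-1 * p%:R^-1 :> R by rewrite expr2 invfM.
have q_lt : abs (ratr q) < p%:R.
  have -> : ratr q = x - (x - ratr q) by rewrite opprB addrC subrK.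
  apply: le_lt_trans (rnormB Qp_abs_ring _ _) _; nra.
(* Since q is in lowest terms, a factor p in its denominator would give it an
   absolute value of at least p. *)
have p_den : coprime p `|denq q|.
  rewrite prime_coprime //; apply/negP => pden.
  have [q0|q0] := eqVneq q 0.
    by rewrite q0 in pden; move: pden; rewrite dvdn1 => /eqP p1; have := prime_gt1 p_prime; rewrite p1.
  move: q_lt; rewrite (Qp_abs_rat QpP) /padic_abs (negbTE q0).
  have -> : logn p `|numq q| = 0%N.
    apply: logn_coprime; apply: coprime_dvdl pden _.
    by rewrite coprime_sym coprime_num_den.
  rewrite expr0 invr1 mul1r; apply/negP; rewrite -leNgt.
  rewrite -[leLHS]expr1 ler_weXn2l //; first exact: ltW.
  by rewrite -pfactor_dvdn ?expn1 // absz_gt0 denq_neq0.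
have /coprimezP [[u v] /= uv1] : coprimez (p ^ 2)%:Z (denq q).
  by rewrite coprimezE absz_nat coprimeXl.
have pn0 : (p ^ 2)%:Z != 0 by rewrite eqz_nat -lt0n expn_gt0 prime_gt0.
(* v inverts the denominator modulo p ^ 2, so c is the residue of q. *)
pose c := ((numq q * v) %% (p ^ 2)%:Z)%Z.
have c_ge0 : 0 <= c by apply: modz_ge0.
have cE : c = numq q * v - (numq q * v %/ (p ^ 2)%:Z)%Z * (p ^ 2)%:Z.
  by rewrite [X in X - _](divz_eq _ (p ^ 2)%:Z) addrC addrA addNr add0r.
have c_lt : (`|c| < p ^ 2)%N.
  by rewrite -ltz_nat gez0_abs //; apply: ltz_pmod; rewrite ltz_nat expn_gt0 prime_gt0.
move: c c_ge0 cE c_lt => c c_ge0 cE c_lt; exists (Ordinal c_lt) => /=.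
have cQp : (`|c|%N)%:R = c%:~R :> Qp by rewrite -[in RHS](gez0_abs c_ge0).
have den0 : (denq q)%:~R != 0 :> Qp.
  apply/eqP => /(Qp_abs_eq0 QpP); rewrite Qp_abs_coprime // => /eqP.
  by rewrite oner_eq0.
have qc : abs (ratr q - c%:~R) <= p%:R ^- 2.
  have -> : ratr q - c%:~R = (numq q - c * denq q)%:~R / (denq q)%:~R :> Qp.
    by rewrite /ratr intrB intrM mulrBl mulfK.
  have [w ->] : exists w, numq q - c * denq q = (p ^ 2)%:Z * w.
    exists (numq q * u + (numq q * v %/ (p ^ 2)%:Z)%Z * denq q).
    rewrite cE -[X in X - _]mulr1 -uv1; ring.
  have abs_den : abs (denq q)%:~R = 1 by exact: Qp_abs_coprime.
  have := Qp_absM QpP ((((p ^ 2)%:Z * w)%:~R) / (denq q)%:~R) (denq q)%:~R.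
  rewrite mulfVK // abs_den mulr1 => <-.
  have pp : (p ^ 2)%:Z%:~R = p%:R ^+ 2 :> Qp by rewrite -natrX.
  rewrite intrM (Qp_absM QpP) -[leRHS]mulr1 ler_pM ?Qp_abs_int_le1 ?(Qp_abs_ge0 QpP) //.
  by rewrite pp Qp_absX Qp_abs_p exprVn.
have -> : x - (`|c|%N)%:R = (x - ratr q) + (ratr q - c%:~R) by rewrite addrA subrK cQp.
apply: le_trans (Qp_absD QpP _ _) _; nra.
Qed.

End Padic.

(** * Roots of elements close to 1 *)

Section Roots.
Variables (R : realType) (F : fieldType) (nu : F -> R) (C : R).
Hypotheses (nuP : ring_norm nu C) (nu_complete : complete nu).
Hypothesis nu_eq0 : forall x, nu x = 0 -> x = 0.

(** The cofactor of y - y' in y ^ m - y' ^ m, near (1, 1). *)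
Lemma exp_differences_tendsto m :
  tendsto (fun y : F * F => Num.max (nu (y.1 - 1)) (nu (y.2 - 1))) nu
    (fun y => \sum_(i < m) y.1 ^+ (m.-1 - i) * y.2 ^+ i) m%:R.
Proof.
have -> : m%:R = \sum_(i < m) 1 ^+ (m.-1 - i) * 1 ^+ i :> F.
  rewrite (eq_bigr (fun=> 1)) ?sumr_const ?card_ord // => i _.
  by rewrite !expr1n mulr1.
apply: (tendsto_sum nuP) => i _.
apply: (tendstoM nuP); apply: (tendstoX nuP) => e e0; exists e => // y;
  by rewrite gt_max => /andP[].
Qed.

(** Newton's iteration with the derivative frozen at 1. It contracts near 1,
    since y ^ m - y' ^ m = (y - y') * s with s tending to m. *)
Lemma root_near1 m : m%:R != 0 :> F ->
  forall e : R, 0 < e -> exists2 d, 0 < d &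
    forall u, nu (u - 1) < d -> exists2 y, y ^+ m = u & nu (y - 1) < e.
Proof.
move=> m0 e e0; have C0 := rnorm_gt0 nuP.
pose T (u y : F) := y - (y ^+ m - u) / m%:R.
have [r r0 contraction] : exists2 r : R, 0 < r & forall u y y',
    nu (y - 1) < r -> nu (y' - 1) < r -> nu (T u y - T u y') <= nu (y - y') / 2.
  have c0 : 0 < C * (C * nu m%:R^-1 + 1) * 2.
    by rewrite !mulr_gt0 // ltr_wpDl ?mulr_ge0 ?(rnorm_ge0 nuP) // ltW.
  have iC0 : 0 < (C * (C * nu m%:R^-1 + 1) * 2)^-1 by rewrite invr_gt0.
  have [r r0 rP] := @exp_differences_tendsto m _ iC0.
  exists r => // u y y' yr y'r.
  have {rP} := rP (y, y'); rewrite gt_max yr y'r /= => /(_ isT).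
  set s := \sum_(i < m) _ => sm.
  have -> : T u y - T u y' = (y - y') * (m%:R^-1 * - (s - m%:R)).
    have xs : y ^+ m - y' ^+ m = (y - y') * s by rewrite subrXX.
    have -> : T u y - T u y' = (y - y') - (y ^+ m - y' ^+ m) / m%:R.
      by rewrite /T; field.
    by rewrite xs; field.
  apply: le_trans (rnormM nuP _ _) _.
  have := rnormM nuP m%:R^-1 (- (s - m%:R)); rewrite (rnormN nuP).
  have y0 := rnorm_ge0 nuP (y - y'); have w0 := rnorm_ge0 nuP m%:R^-1.
  move: sm; rewrite invfM invfM => sm wm.
  have -> : nu (y - y') / 2 = C * nu (y - y') * (C^-1 / 2).
    by field; rewrite gt_eqF.
  apply: ler_wpM2l; first by rewrite mulr_ge0 // ltW.
  apply: le_trans wm _; apply: (@le_trans _ _ ((C * nu m%:R^-1 + 1) * nu (s - m%:R))).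
    by rewrite ler_wpM2r ?(rnorm_ge0 nuP) // lerDl.
  have B0 : 0 < C * nu m%:R^-1 + 1 by rewrite ltr_wpDl ?mulr_ge0 // ltW.
  by rewrite mulrC -ler_pdivlMr // mulrAC ltW.
have w0 := rnorm_ge0 nuP m%:R^-1.
pose B := C * nu m%:R^-1 + 1.
have B0 : 0 < B by rewrite ltr_wpDl ?mulr_ge0 // ltW.
pose d := Num.min r e / (4 * B).
have re0 : 0 < Num.min r e by rewrite lt_min r0.
exists d => [|u ud]; first by rewrite divr_gt0 ?mulr_gt0.
pose y := fix y n := if n is n'.+1 then T u (y n') else 1.
have y1 : nu (y 1%N - y 0%N) <= Num.min r e / 4.
  have -> : y 1%N - y 0%N = (u - 1) * m%:R^-1 by rewrite /= /T expr1n; field.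
  have : (4 * B) * nu (u - 1) <= Num.min r e.
    by rewrite mulrC -ler_pdivlMr ?mulr_gt0 // ltW.
  have := rnormM nuP (u - 1) m%:R^-1; have := rnorm_ge0 nuP (u - 1).
  by rewrite /B; nra.
set b := Num.min r e in re0 y1.
have [br be] : b <= r /\ b <= e by rewrite /b !ge_min !lexx orbT.
have pow2_gt0 n : 0 < 2 ^- n :> R by rewrite invr_gt0 exprn_gt0.
(* The first step is at most b / 4, so all the iterates stay within b / 2 of 1. *)
have y_dist n : nu (y n - 1) <= b / 2 * (1 - 2 ^- n) /\ nu (y n.+1 - y n) <= b / 4 * 2 ^- n.
  elim: n => [|n [IHn IHn']].
    by rewrite expr0 invr1 mulr1 !subrr (rnorm0 nuP) mulr0.
  have E : 2 ^- n.+1 = 2 ^- n / 2 :> R by rewrite exprS invfM mulrC.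
  have n0 := pow2_gt0 n.
  have near : nu (y n.+1 - 1) <= b / 2 * (1 - 2 ^- n.+1).
    have -> : y n.+1 - 1 = (y n.+1 - y n) + (y n - 1) by rewrite addrA subrK.
    apply: le_trans (rnormD nuP _ _) _; rewrite E; lra.
  split=> //; have := contraction u (y n.+1) (y n) _ _; rewrite E => contr.
  apply: le_trans (contr _ _) _; [| |lra].
  - by apply: le_lt_trans near _; rewrite E; nra.
  - by apply: le_lt_trans IHn _; nra.
have y_near n : nu (y n - 1) < r.
  by apply: le_lt_trans (y_dist n).1 _; have := pow2_gt0 n; nra.
have b40 : 0 <= b / 4 by rewrite divr_ge0 // ltW.
have [l lP] := geometric_limit nuP nu_complete b40 (fun n => (y_dist n).2).
have l1 : nu (l - 1) < b.
  have := lP 0%N; rewrite expr0 invr1 mulr1 /= (rnorm_distC nuP).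
  lra.
have lr : nu (l - 1) < r := lt_le_trans l1 br.
exists l; last exact: lt_le_trans l1 be.
suff Tl : T u l - l = 0.
  apply/eqP; rewrite -subr_eq0; move/eqP: Tl.
  by rewrite /T addrAC subrr add0r oppr_eq0 mulf_eq0 invr_eq0 (negbTE m0) orbF.
apply: nu_eq0; apply/eqP; rewrite eq_le (rnorm_ge0 nuP) andbT.
apply/ler_addgt0Pr => x x0; rewrite add0r.
have [n nP] := pow2_small b x0.
have -> : T u l - l = (y n.+1 - l) - (T u (y n) - T u l).
  by rewrite opprB [RHS]addrC addrA subrK.
apply: le_trans (rnormB nuP _ _) _.
have := contraction u (y n) l (y_near n) lr.
have := lP n; have := lP n.+1; rewrite exprS invfM.
have : 0 < b * 2 ^- n by rewrite mulr_gt0.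
lra.
Qed.

End Roots.

(** * Compactness of the unit ball *)

Section UnitBall.
Variables (R : realType) (p : nat) (p_prime : prime p).
Variables (Qp : fieldType) (abs : Qp -> R) (QpP : is_Qp p abs).
Variable V : falgType Qp.
Local Notation N := (coord_norm abs (V := V)).
Local Notation e := (vbasis {:V}).

Let absP := Qp_abs_ring QpP.
Let p_gt0 : 0 < p%:R :> R. Proof. by rewrite ltr0n prime_gt0. Qed.

(** Representatives, with repetitions, of the unit ball modulo p. *)
Definition digit (c : {ffun 'I_(\dim {:V}) -> 'I_(p ^ 2)}) : V :=
  \sum_i (c i)%:R *: e`_i.

Lemma digit_norm c : N (digit c) <= 1.
Proof.
apply: coord_norm_le => // i.
rewrite /digit (coord_sum_free (fun i => (c i)%:R)) ?(basis_free (vbasisP _)) //.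
exact: (Qp_abs_nat_le1 p_prime QpP).
Qed.

Lemma ball_digit k (x : V) : N x <= p%:R ^- k ->
  exists c, N (x - p%:R ^+ k *: digit c) <= p%:R ^- k.+1.
Proof.
move=> xk.
have pk0 : 0 < p%:R ^- k :> R by rewrite invr_gt0 exprn_gt0.
have pQ0 : p%:R ^+ k != 0 :> Qp by rewrite expf_neq0 // (Qp_nat_neq0 p_prime QpP) ?prime_gt0.
have abspk : abs (p%:R ^+ k) = p%:R ^- k.
  by rewrite (Qp_absX QpP) (Qp_abs_p p_prime QpP) exprVn.
have /choice [c cP] i : exists c : 'I_(p ^ 2),
    abs (coord e i x - p%:R ^+ k * c%:R) <= p%:R ^- k.+1.
  pose y := coord e i x / p%:R ^+ k.
  have xE : coord e i x = p%:R ^+ k * y by rewrite mulrC divfK.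
  have y1 : abs y <= 1.
    rewrite -(ler_pM2l pk0) mulr1 -{1}abspk -(Qp_absM QpP) -xE.
    exact: le_trans (coord_le_norm _ _ _) xk.
  have [c cP] := Qp_digit p_prime QpP y1; exists c.
  by rewrite xE -mulrBr (Qp_absM QpP) abspk exprSr invfM ler_pM2l.
exists (finfun c); apply: coord_norm_le => [|i].
  by rewrite invr_ge0 exprn_ge0 // ltW.
rewrite linearB linearZ /= /digit.
rewrite (coord_sum_free (fun i => (finfun c i)%:R)) ?(basis_free (vbasisP _)) //.
by rewrite ffunE.
Qed.

(** Nested balls: if the unit ball were not small, some ball of radius 1/p
    inside it would not be small either, and so on; the centres converge, and a
    small neighbourhood of the limit contains one of these balls. *)
Lemma unit_ball_small (small : set (set V)) :
    complete abs ->
    small set0 ->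
    (forall X Y, small X -> small Y -> small (X `|` Y)) ->
    (forall X Y, X `<=` Y -> small Y -> small X) ->
    (forall x, exists2 d : R, 0 < d & small [set y | N (y - x) < d]) ->
  small [set y | N y <= 1].
Proof.
move=> abs_complete small0 smallU smallS small_loc; apply: contrapT => nsmall.
pose ball (k : nat) a : set V := [set y | N (y - a) <= p%:R ^- k].
have small_bigU (I : finType) (B : I -> set V) :
    (forall i, small (B i)) -> small [set y | exists i, B i y].
  move=> smallB.
  suff : small [set y | exists2 i, i \in enum I & B i y].
    by apply: smallS => y [i Biy]; exists i; rewrite ?mem_enum.
  elim: (enum I) => [|i r IHr]; first by apply: smallS small0 => y [].
  apply: smallS (smallU _ _ (smallB i) IHr) => y [k].
  by rewrite inE => /orP[/eqP ->|kr] By; [left | right; exists k].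
have step (s : nat * V) : exists a, ~ small (ball s.1 s.2) ->
    ~ small (ball s.1.+1 a) /\ N (a - s.2) <= p%:R ^- s.1.
  case: s => k a /=; have [sm|nsm] := pselect (small (ball k a)); first by exists a.
  have [[c cP]|nc] := pselect (exists c, ~ small (ball k.+1 (a + p%:R ^+ k *: digit c))).
    exists (a + p%:R ^+ k *: digit c) => _; split=> //.
    rewrite addrAC subrr add0r; apply: le_trans (coord_normZ absP _ _) _.
    rewrite mul1r (Qp_absX QpP) (Qp_abs_p p_prime QpP) exprVn.
    by rewrite -[leRHS]mulr1 ler_wpM2l ?digit_norm // invr_ge0 exprn_ge0 // ltW.
  case: nsm.
  apply: smallS (small_bigU _ (fun c => ball k.+1 (a + p%:R ^+ k *: digit c)) _).
    by move=> y /ball_digit [c cP]; exists c; rewrite /ball /= opprD addrA.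
  by move=> c; apply: contrapT => nsm; apply: nc; exists c.
have [next nextP] := choice step.
pose a := fix a k := if k is k'.+1 then next (k', a k') else 0.
have aP k : ~ small (ball k (a k)).
  elim: k => [|k IHk]; last by have [] := nextP (k, a k) IHk.
  by move=> sm; apply: nsmall; apply: smallS sm => y /=; rewrite /ball /= subr0 invr1.
have a_dist k : N (a k.+1 - a k) <= 1 * 2 ^- k.
  have [_ /le_trans] := nextP (k, a k) (aP k); apply.
  by rewrite mul1r lef_pV2 ?posrE ?exprn_gt0 // lerXn2r ?nnegrE ?ler0n ?ler_nat ?prime_gt1.
have [C NP] := coord_norm_ring absP V.
have N_complete := coord_norm_complete (V := V) abs_complete.
have [l lP] := geometric_limit NP N_complete ler01 a_dist.
have [d d0 small_d] := small_loc l.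
have [n nP] := pow2_small 3 d0.
apply: (aP n); apply: smallS small_d => y; rewrite /ball /= => yn.
have -> : y - l = (y - a n) + (a n - l) by rewrite addrA subrK.
apply: le_lt_trans (rnormD NP _ _) _; apply: le_lt_trans nP.
have pn2 : p%:R ^- n <= 2 ^- n :> R.
  by rewrite lef_pV2 ?posrE ?exprn_gt0 // lerXn2r ?nnegrE ?ler0n ?ler_nat ?prime_gt1.
have := lP n; lra.
Qed.

End UnitBall.

(** * Finiteness of the group of m-th power classes *)

Section PowerClasses.
Variables (R : realType) (p : nat) (p_prime : prime p).
Variables (Qp : fieldType) (abs : Qp -> R) (QpP : is_Qp p abs).
Variables (F : fieldExtType Qp) (m : nat) (m_gt0 : (0 < m)%N).
Local Notation N := (coord_norm abs (V := F)).

Let absP := Qp_abs_ring QpP.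
Let p_gt1 : 1 < p%:R :> R. Proof. by rewrite ltr1n prime_gt1. Qed.
Let p_gt0 : 0 < p%:R :> R. Proof. exact: lt_trans p_gt1. Qed.

Lemma ext_norm_complete : complete N.
Proof. exact/coord_norm_complete/(Qp_complete QpP). Qed.

Lemma ext_norm_eq0 x : N x = 0 -> x = 0.
Proof. by apply: (coord_norm_eq0 absP) => a /(Qp_abs_eq0 QpP). Qed.

Lemma ext_norm_gt0 x : x != 0 -> 0 < N x.
Proof.
move=> x0; rewrite lt_neqAle coord_norm_ge0 andbT eq_sym.
by apply: contra x0 => /eqP /ext_norm_eq0 ->.
Qed.

Lemma ext_nat_neq0 n : (0 < n)%N -> n%:R != 0 :> F.
Proof.
move=> n0; rewrite -scaler_nat scaler_eq0 oner_eq0 orbF.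
exact: (Qp_nat_neq0 p_prime QpP).
Qed.

Lemma ext_root_near1 (e : R) : 0 < e -> exists2 d, 0 < d &
  forall u : F, N (u - 1) < d -> exists2 y, y ^+ m = u & N (y - 1) < e.
Proof.
have [C NP] := coord_norm_ring absP F.
by apply: (root_near1 NP ext_norm_complete ext_norm_eq0); exact: ext_nat_neq0.
Qed.

Let pk (k : nat) : Qp := p%:R ^+ k.
Let abs_pk k : abs (pk k) = p%:R ^- k.
Proof. by rewrite (Qp_absX QpP) (Qp_abs_p p_prime QpP) exprVn. Qed.
Let pk0 k : pk k != 0.
Proof. by rewrite expf_neq0 // (Qp_nat_neq0 p_prime QpP) // prime_gt0. Qed.
Let abs_pkV k : abs (pk k)^-1 = p%:R ^+ k.
Proof.
have := Qp_absM QpP (pk k) (pk k)^-1; rewrite mulfV // abs_pk.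
rewrite (Qp_abs_int QpP (z := 1)) // logn1 invr1 => E.
by rewrite -[LHS](mulKf (x := p%:R ^- k)) -?E ?invr_eq0 ?mulr1 ?invrK // expf_neq0 // gt_eqF.
Qed.

Lemma pow_p_gt (B : R) : exists n, B < p%:R ^+ n.
Proof.
have [n nP] := pow2_gt B; exists n; apply: lt_le_trans nP _.
by rewrite lerXn2r ?nnegrE ?ler0n ?ler_nat ?prime_gt1.
Qed.

(** Powers of p ^ m bring every nonzero x to a fixed annulus. *)
Lemma power_class_annulus (x : F) : x != 0 -> exists s y : F,
  [/\ p%:R ^- m < N s, N s <= 1, y != 0 & x = s * y ^+ m].
Proof.
move=> x0.
have NZ a (z : F) : N (a *: z) <= abs a * N z.
  by have := coord_normZ absP a z; rewrite mul1r.
have le_exp k : p%:R ^+ k <= p%:R ^+ (m * k) :> R.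
  by rewrite ler_weXn2l ?leq_pmull // ltW.
have [a aP] := pow_p_gt (N x).
pose x1 := pk (m * a) *: x.
have x1_le : N x1 <= 1.
  apply: le_trans (NZ _ _) _; rewrite abs_pk mulrC ler_pdivrMr ?exprn_gt0 // mul1r.
  exact: le_trans (ltW aP) (le_exp a).
have x1_gt : 0 < N x1 by rewrite ext_norm_gt0 // scaler_eq0 negb_or pk0.
(* s is the last of the multiples of x1 by powers of p ^ -m to remain in the
   unit ball, so that its norm exceeds p ^ -m. *)
have big : exists b, 1 < N ((pk (m * b))^-1 *: x1).
  have [b bP] := pow_p_gt (N x1)^-1; exists b.
  have := NZ (pk (m * b)) ((pk (m * b))^-1 *: x1).
  rewrite scalerA mulfV // scale1r abs_pk mulrC ler_pdivlMr ?exprn_gt0 //.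
  apply: lt_le_trans; rewrite mulrC -ltr_pdivrMr // mul1r.
  exact: lt_le_trans bP (le_exp b).
case: (ex_minnP big) => -[|b] big_b min_b.
  by move: big_b; rewrite muln0 /pk expr0 invr1 scale1r ltNge x1_le.
pose s := (pk (m * b))^-1 *: x1.
exists s, ((pk b / pk a)%:A); split.
- have := NZ (pk m)^-1 s; rewrite abs_pkV /s scalerA -invfM /pk -exprD -mulnS => le_s.
  rewrite -[_ ^- _]mul1r ltr_pdivrMr ?exprn_gt0 // mulrC.
  exact: lt_le_trans big_b le_s.
- by rewrite leNgt; apply/negP => /min_b; rewrite ltnn.
- by rewrite scaler_eq0 negb_or oner_eq0 andbT mulf_neq0 ?invr_eq0.
- have pkM k : pk (m * k) = pk k ^+ m by rewrite /pk mulnC exprM.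
  rewrite exprZn expr1n mulr_algr /s /x1 !scalerA !pkM expr_div_n.
  by rewrite mulrAC divfK ?divff ?scale1r // expf_neq0.
Qed.

(** By compactness of the annulus: the class of x contains a neighbourhood of
    x, as quotients close to 1 are m-th powers. *)
Lemma finite_power_classes : exists r : seq F,
  forall x : F, x != 0 -> exists c y, [/\ c \in r, y != 0 & x = c * y ^+ m].
Proof.
have [C NP] := coord_norm_ring absP F.
pose small (X : set F) := exists r : seq F, forall x, X x -> p%:R ^- m < N x ->
  exists c y, [/\ c \in r, y != 0 & x = c * y ^+ m].
have pm0 : 0 < p%:R ^- m :> R by rewrite invr_gt0 exprn_gt0.
have [r rP] : small [set y | N y <= 1].
  apply: (unit_ball_small p_prime QpP) => //.
  - exact: Qp_complete QpP.
  - by exists [::].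
  - move=> X Y [r rX] [r' rY]; exists (r ++ r') => x [/rX xr|/rY xr] /xr [c [y [cr y0 xE]]].
      by exists c, y; rewrite mem_cat cr.
    by exists c, y; rewrite mem_cat cr orbT.
  - by move=> X Y XY [r rY]; exists r => x /XY; exact: rY.
  move=> x; have [->|x0] := eqVneq x 0.
    exists (p%:R ^- m) => //; exists [::] => y /=; rewrite subr0 => ylt /(lt_trans ylt).
    by rewrite ltxx.
  have [d d0 dP] := ext_root_near1 ltr01.
  have [e e0 eP] := rnorm_mul_small NP 1 x^-1 d0.
  exists e => //; exists [:: x] => y /= yx ygt.
  have [|z zE _] := dP (y / x).
    by have := eP _ yx; rewrite mul1r mulrBl mulfV.
  exists x, z; rewrite inE eqxx zE mulrC divfK //; split=> //.
  apply: contraTneq ygt => z0; move: zE; rewrite z0 expr0n gtn_eqF //= => /esym /eqP.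
  rewrite mulf_eq0 invr_eq0 (negbTE x0) orbF => /eqP ->.
  by rewrite (rnorm0 NP) -leNgt ltW.
exists r => x /power_class_annulus [s [y [s_gt s1 y0 ->]]].
have [c [z [cr z0 ->]]] := rP s s1 s_gt.
by exists c, (z * y); rewrite mulf_neq0 // exprMn mulrA.
Qed.

End PowerClasses.

(** * The reduced norm *)

Section ReducedNorm.
Variables (R : realType) (p : nat) (p_prime : prime p).
Variables (Qp : fieldType) (abs : Qp -> R) (QpP : is_Qp p abs).
Variables (F : fieldExtType Qp) (D : falgType F) (n : nat) (n_gt0 : (0 < n)%N).
Variables (Nrd : 'M[D]_n -> F) (NrdP : is_reduced_norm Nrd).
Local Notation nF := (coord_norm abs (V := F)).
Local Notation nD := (coord_norm nF (V := D)).
Local Notation nM := (@mxD_norm R Qp abs F D n).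
Local Notation scal a := ((a%:A)%:M : 'M[D]_n).

Lemma scalM a b : scal (a * b) = scal a *m scal b.
Proof. by rewrite -scalar_mxM -scalerAl mul1r scalerA. Qed.

Lemma scal1 : scal (1 : F) = 1%:M.
Proof. by rewrite scale1r. Qed.

Lemma scalVK a : a != 0 -> scal a *m scal a^-1 = 1%:M.
Proof. by move=> a0; rewrite -scalM divff // scal1. Qed.

Lemma scal_central a (x : 'M[D]_n) : scal a *m x = x *m scal a.
Proof.
apply/matrixP => i k; rewrite mul_scalar_mx -diag_const_mx mul_mx_diag !mxE.
by rewrite mulr_algl mulr_algr.
Qed.

Lemma NrdM x y : Nrd (x *m y) = Nrd x * Nrd y.
Proof.
have [L [phi [_ phiE]]] := NrdP; apply: (fmorph_inj (in_alg L)).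
by rewrite rmorphM /= -!phiE rmorphM -det_mulmx.
Qed.

Lemma Nrd1 : Nrd 1%:M = 1.
Proof.
have [L [phi [_ phiE]]] := NrdP; apply: (fmorph_inj (in_alg L)).
by rewrite /= -phiE rmorph1 det1 scale1r.
Qed.

Lemma Nrd_scal a : Nrd (scal a) = a ^+ (2 * n).
Proof.
have [L [phi [phi_lin phiE]]] := NrdP; apply: (fmorph_inj (in_alg L)).
rewrite /= -phiE -[X in phi X]mulmx1 phi_lin rmorph1 mulmx1 det_scalar.
by rewrite exprZn expr1n.
Qed.

Lemma Nrd_neq0 g : GL g -> Nrd g != 0.
Proof.
move=> [h [gh _]]; apply/eqP => g0; have := congr1 Nrd gh.
by rewrite NrdM g0 mul0r Nrd1 => /esym/eqP; rewrite oner_eq0.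
Qed.

Lemma GL_subgroup : is_subgroup (@GL D n) (@GL D n).
Proof.
split=> //; first by exists 1%:M; rewrite !mulmx1.
  move=> g h [g' [gg' g'g]] [h' [hh' h'h]]; exists (h' *m g').
  by rewrite !mulmxA -(mulmxA g) hh' mulmx1 gg' -(mulmxA h') g'g mulmx1.
by move=> g [h [gh hg]]; exists h; split=> //; exists g.
Qed.

Lemma SL_subgroup : is_subgroup (@GL D n) (SL Nrd).
Proof.
have [_ G1 GM GV] := GL_subgroup; split.
- exact: SL_sub_GL.
- by split; [exact: G1 | exact: Nrd1].
- by move=> g h [Gg g1] [Gh h1]; split; [exact: GM | rewrite NrdM g1 h1 mulr1].
- move=> g [Gg g1]; have [h [Gh gh hg]] := GV g Gg; exists h; split=> //; split=> //.
  by have := congr1 Nrd gh; rewrite NrdM g1 mul1r Nrd1.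
Qed.

Lemma SL_normal g g' s :
  GL g -> GL g' -> g *m g' = 1%:M -> SL Nrd s -> SL Nrd (g *m s *m g').
Proof.
move=> Gg Gg' gg' [Gs s1]; have [_ _ GM _] := GL_subgroup; split.
  by apply: (GM) => //; exact: GM.
by rewrite !NrdM s1 mulr1 -NrdM gg' Nrd1.
Qed.

Let absP := Qp_abs_ring QpP.

Lemma nM_ring : exists C, ring_norm nM C.
Proof.
have [CF nFP] := coord_norm_ring absP F; have [CD nDP] := coord_norm_ring nFP D.
by eexists; exact: mx_norm_ring nDP n.
Qed.

Lemma nM_scal : exists2 c : R, 0 <= c & forall a, nM (scal a) <= c * nF a.
Proof.
have [CF nFP] := coord_norm_ring absP F; have CF0 := rnorm_gt0 nFP.
have c0 : 0 <= CF * nD 1 by rewrite mulr_ge0 ?coord_norm_ge0 // ltW.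
exists (CF * nD 1) => // a.
apply: mx_norm_le => [|i k]; first by rewrite mulr_ge0 ?coord_norm_ge0.
rewrite mxE; case: (i == k) => /=; first by rewrite mulrAC mulr1n coord_normZ.
by rewrite mulr0n (coord_norm0 nFP) mulr_ge0 ?coord_norm_ge0.
Qed.

(** An F-linear map out of the matrix algebra is bounded by its values on the
    matrices with a single nonzero entry, taken in a basis of D. *)
Lemma scalar_linear_bounded (L : fieldExtType F) (m : nat)
    (phi : {rmorphism 'M[D]_n -> 'M[L]_m}) (a b : 'I_m) :
  scalar_linear phi ->
  exists2 B : R, 0 < B & forall x, coord_norm nF (V := L) (phi x a b) <= B * nM x.
Proof.
move=> phi_lin; have [CF nFP] := coord_norm_ring absP F; have CF0 := rnorm_gt0 nFP.
have [CD nDP] := coord_norm_ring nFP D.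
pose e := vbasis {:D}.
pose E (i k : 'I_n) (l : 'I_(\dim {:D})) : 'M[D]_n := e`_l *: delta_mx i k.
pose nL := coord_norm nF (V := L).
pose B := \sum_i \sum_k \sum_l CF * nL (phi (E i k l) a b).
have B0 : 0 <= B.
  by do 3!(apply: sumr_ge0 => ? _); rewrite mulr_ge0 ?coord_norm_ge0 // ltW.
exists (B + 1) => [|x]; first by rewrite ltr_wpDl.
apply: (@le_trans _ _ (B * nM x)); last by rewrite ler_wpM2r ?mx_norm_ge0 // lerDl.
have -> : phi x a b = \sum_i \sum_k \sum_l coord e l (x i k) *: phi (E i k l) a b.
  rewrite {1}[x]matrix_sum_delta rmorph_sum summxE; apply: eq_bigr => i _.
  rewrite rmorph_sum summxE; apply: eq_bigr => k _.
  rewrite {1}[x i k](coord_expand (V := D)) scaler_suml rmorph_sum summxE.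
  apply: eq_bigr => l _.
  have -> : (coord e l (x i k) *: e`_l) *: delta_mx i k = scal (coord e l (x i k)) *m E i k l.
    by rewrite mul_scalar_mx scalerA mulr_algl.
  by rewrite phi_lin mul_scalar_mx mxE mulr_algl.
rewrite mulr_suml; apply: le_trans (coord_norm_sum nFP _ _ _) _; apply: ler_sum => i _.
rewrite mulr_suml; apply: le_trans (coord_norm_sum nFP _ _ _) _; apply: ler_sum => k _.
rewrite mulr_suml; apply: le_trans (coord_norm_sum nFP _ _ _) _; apply: ler_sum => l _.
apply: le_trans (coord_normZ nFP _ _) _.
rewrite mulrAC ler_wpM2l ?mulr_ge0 ?coord_norm_ge0 ?(ltW CF0) //.
exact: le_trans (coord_le_norm _ _ _) (mx_le_norm _ _ _ _).
Qed.

(** Over the splitting field the reduced norm is a determinant, a polynomial in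
    bounded linear forms. A nonzero coordinate of 1 then recovers Nrd g from its
    image in L. *)
Lemma Nrd_near1 (e : R) : 0 < e -> exists2 d : R, 0 < d &
  forall g, nM (g - 1%:M) < d -> nF (Nrd g - 1) < e.
Proof.
move=> e0; have [CF nFP] := coord_norm_ring absP F; have CF0 := rnorm_gt0 nFP.
have [L [phi [phi_lin phiE]]] := NrdP.
have [CL nLP] := coord_norm_ring nFP L.
pose nL := coord_norm nF (V := L).
pose rho (x : 'M[D]_n) := nM (x - 1%:M).
have det_lim : tendsto rho nL (fun x => \det (phi x)) (\det (1%:M : 'M[L]_(2 * n))).
  apply: (tendsto_sum nLP) => s _; apply: (tendstoM nLP); first exact: tendsto_cst nLP _.
  apply: (tendsto_prod nLP) => i _ d d0.
  have [B B0 BP] := scalar_linear_bounded i (s i) phi_lin.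
  exists (d / B) => [|x]; first exact: divr_gt0.
  rewrite ltr_pdivlMr // mulrC; apply: le_lt_trans.
  have := BP (x - 1%:M); rewrite rmorphB rmorph1.
  by rewrite /nL [in X in X -> _]mxE [in X in X -> _]mxE.
have [k k0] : exists k, coord (vbasis {:L}) k 1 != 0.
  apply: contrapT => nk; have /eqP := oner_neq0 L; apply.
  rewrite [LHS](coord_expand (V := L)) big1 // => k _.
  suff -> : coord (vbasis {:L}) k 1 = 0 by rewrite scale0r.
  by apply: contrapT => /eqP k0; apply: nk; exists k.
set c := coord _ k 1 in k0.
have [d d0 dP] := rnorm_mul_small nFP 1 c^-1 e0.
have [d' d'0 d'P] := det_lim d d0; exists d' => // g /d'P gd.
have -> : Nrd g - 1 = 1 * coord (vbasis {:L}) k (\det (phi g) - \det (1%:M : 'M[L]_(2 * n))) * c^-1.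
  have -> : \det (phi g) - \det (1%:M : 'M[L]_(2 * n)) = (Nrd g - 1) *: (1 : L).
    by rewrite phiE det1 scalerBl scale1r.
  by rewrite linearZ mul1r mulfK.
apply: dP; exact: le_lt_trans (coord_le_norm _ _ _) gd.
Qed.

Let m_gt0 : (0 < 2 * n)%N. Proof. by rewrite muln_gt0. Qed.

(** The index of the product of SL with the scalars is finite, because the
    reduced norm of a scalar a is the power of a of exponent 2n. *)
Lemma GL_cosets : exists (I : finType) (t t' : I -> 'M[D]_n),
  [/\ forall i, [/\ GL (t i), GL (t' i), t i *m t' i = 1%:M & t' i *m t i = 1%:M]
    & forall g, GL g -> exists i (a : F) s,
        [/\ a != 0, SL Nrd s & g = t i *m scal a *m s]].
Proof.
have [_ G1 GM GV] := GL_subgroup.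
have [r rP] := finite_power_classes p_prime QpP F m_gt0.
pose meets (c : F) g := exists2 y : F, y != 0 & Nrd g = c * y ^+ (2 * n).
have /choice [tt ttP] (i : 'I_(size r)) : exists u : 'M[D]_n * 'M[D]_n,
    [/\ GL u.1, GL u.2, u.1 *m u.2 = 1%:M, u.2 *m u.1 = 1%:M &
        forall g, GL g -> meets r`_i g -> meets r`_i u.1].
  have [[g [Gg gi]]|ng] := pselect (exists g, GL g /\ meets r`_i g).
    by have [h [Gh gh hg]] := GV g Gg; exists (g, h).
  exists (1%:M, 1%:M); rewrite /= !mulmx1; split=> // g Gg gi.
  by case: ng; exists g.
exists 'I_(size r), (fun i => (tt i).1), (fun i => (tt i).2); split.
  by move=> i; case: (ttP i).
move=> g Gg; have [c [y [cr y0 gE]]] := rP _ (Nrd_neq0 Gg).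
have ci : (index c r < size r)%N by rewrite index_mem.
have [] := ttP (Ordinal ci); rewrite /= nth_index //.
set t := (tt _).1; set t' := (tt _).2 => Gt Gt' tt' t't /(_ g Gg) [|z z0 tE]; first by exists y.
have Gscal a : a != 0 -> GL (scal a).
  by move=> a0; exists (scal a^-1); split; [|rewrite scal_central]; exact: scalVK.
exists (Ordinal ci), (y / z), (t' *m scal (z / y) *m g); split.
- by rewrite mulf_neq0 ?invr_eq0.
- split; first by do 2!apply: (GM) => //; apply: Gscal; rewrite mulf_neq0 ?invr_eq0.
  have Nt' : Nrd t * Nrd t' = 1 by rewrite -NrdM tt' Nrd1.
  have ym0 : y ^+ (2 * n) != 0 by rewrite expf_neq0.
  rewrite !NrdM Nrd_scal gE -Nt' tE expr_div_n.
  by move: (y ^+ _) (z ^+ _) ym0 => Y X Y0; field.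
- rewrite -!mulmxA; rewrite -/t.
  have -> : scal (y / z) *m (t' *m (scal (z / y) *m g)) = t' *m g.
    rewrite [scal (y / z) *m _]mulmxA scal_central -!mulmxA; congr (_ *m _).
    by rewrite mulmxA -scalM mulrA divfK // divff // scal1 mul1mx.
  by rewrite mulmxA tt' mul1mx.
Qed.

(** The scalar is a root of exponent 2n of the reduced norm of g, which is close
    to 1 when g is. *)
Lemma GL_near1 (e : R) : 0 < e -> exists2 d : R, 0 < d &
  forall g, GL g -> nM (g - 1%:M) < d -> exists (a : F) s,
    [/\ a != 0, SL Nrd s, g = scal a *m s & nM (s - 1%:M) < e].
Proof.
move=> e0; have [CF nFP] := coord_norm_ring absP F.
have [CM nMP] := nM_ring; have CM0 := rnorm_gt0 nMP.
have [c c0 cP] := nM_scal.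
have [_ _ GM _] := GL_subgroup.
have c10 : 0 < c + 1 by rewrite ltr_wpDl.
have nF1 := rnorm_ge0 nFP 1.
pose e1 := Num.min 1 (e / 2 / (c + 1)).
have e10 : 0 < e1 by rewrite lt_min ltr01 !divr_gt0.
have [e2 e20 e2P] := inv_near1 nFP e10.
have [e3 e30 e3P] := ext_root_near1 p_prime QpP F m_gt0 e20.
have [e4 e40 e4P] := Nrd_near1 e30.
pose B := CM * ((c + 1) * (nF 1 + 1)) * 2.
have B0 : 0 < B by rewrite !mulr_gt0 // ltr_wpDl.
exists (Num.min e4 (e / B)) => [|g Gg]; first by rewrite lt_min e40 divr_gt0.
rewrite lt_min ltr_pdivlMr // => /andP[/e4P/e3P [y yE /e2P]].
rewrite lt_min ltr_pdivlMr // => /andP[y1 y1e] gB.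
have y0 : y != 0.
  apply: contra (Nrd_neq0 Gg) => /eqP y0.
  by rewrite -yE y0 expr0n gtn_eqF.
have Gy : GL (scal y^-1).
  by exists (scal y); split; [rewrite scal_central|]; exact: scalVK.
exists y, (scal y^-1 *m g); split=> //.
- split; first exact: GM.
  by rewrite NrdM Nrd_scal -yE exprVn mulVf // expf_neq0.
- by rewrite mulmxA scalVK // mul1mx.
have -> : scal y^-1 *m g - 1%:M = scal y^-1 *m (g - 1%:M) + scal (y^-1 - 1).
  have -> : scal (y^-1 - 1) = scal y^-1 - 1%:M by rewrite scalerBl scale1r raddfB.
  by rewrite mulmxBr mulmx1 addrA subrK.
apply: le_lt_trans (rnormD nMP _ _) _.
have yV : nF y^-1 <= nF 1 + 1.
  rewrite -[y^-1](subrK 1); apply: le_trans (rnormD nFP _ _) _.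
  by rewrite addrC lerD2l ltW.
have g0 := rnorm_ge0 nMP (g - 1%:M).
have sy : nM (scal y^-1) <= (c + 1) * (nF 1 + 1).
  by apply: le_trans (cP _) _; rewrite ler_pM ?(rnorm_ge0 nFP) // lerDl.
have s1 : nM (scal y^-1 *m (g - 1%:M)) < e / 2.
  apply: le_lt_trans (rnormM nMP _ _) _.
  apply: (@le_lt_trans _ _ (CM * ((c + 1) * (nF 1 + 1)) * nM (g - 1%:M))).
    by rewrite ler_wpM2r // ler_wpM2l // ltW.
  by rewrite ltr_pdivlMr // mulrAC mulrC.
have s2 : nM (scal (y^-1 - 1)) < e / 2.
  apply: le_lt_trans (cP _) _; apply: le_lt_trans y1e.
  by rewrite mulrC ler_wpM2l ?(rnorm_ge0 nFP) // lerDl.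
by rewrite [ltRHS]splitr ltrD.
Qed.

End ReducedNorm.

(** * The subgroup GL_n(E) and the extension *)

Section GLE.
Variables (F : fieldType) (D : falgType F) (E : fieldExtType F) (n : nat).
Variables (j : {rmorphism 'M[E]_n -> 'M[D]_n}) (j_lin : scalar_linear j).

Lemma GLE_subgroup : is_subgroup (@GL D n) (GLE j).
Proof.
have inv (g : 'M[E]_n) : g \in unitmx ->
    j g *m j (invmx g) = 1%:M /\ j (invmx g) *m j g = 1%:M.
  move=> gU; split.
    by have := rmorphM j g (invmx g); rewrite [g * _]mulmxV // rmorph1 => /esym.
  by have := rmorphM j (invmx g) g; rewrite [_ * g]mulVmx // rmorph1 => /esym.
split.
- by move=> _ [g gU <-]; exists (j (invmx g)); exact: inv.
- by exists 1%:M; [exact: unitmx1 | exact: rmorph1].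
- move=> _ _ [g gU <-] [h hU <-]; exists (g *m h); last exact: rmorphM.
  by rewrite /= unitmx_mul gU hU.
- move=> _ [g gU <-]; exists (j (invmx g)); have [gV Vg] := inv g gU; split=> //.
  by exists (invmx g) => //; rewrite /= unitmx_inv.
Qed.

Lemma GLE_scal (a : F) : a != 0 -> GLE j (a%:A)%:M.
Proof.
move=> a0; exists ((a%:A)%:M : 'M[E]_n).
  by rewrite /= unitmxE det_scalar unitfE expf_neq0 // scaler_eq0 negb_or a0 oner_eq0.
by rewrite -[X in j X]mulmx1 j_lin rmorph1 mulmx1.
Qed.

End GLE.

Theorem proposition5p2 (R : realType) (p : nat) (p_prime : prime p)
    (Qp : fieldType) (abs : Qp -> R) (QpP : is_Qp p abs)
    (F : fieldExtType Qp)
    (D : falgType F) (DP : quaternion_division_algebra D)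
    (E : fieldExtType F) (dimE : \dim {:E} = 2%N)
    (iota : {lrmorphism E -> D})
    (n : nat) (n_gt0 : (0 < n)%N)
    (j : {rmorphism 'M[E]_n -> 'M[D]_n}) (j_lin : scalar_linear j)
    (Nrd : 'M[D]_n -> F) (NrdP : is_reduced_norm Nrd)
    (pi_flat : representation R (SL Nrd))
    (pi_flat_irr : irreducible_rep pi_flat)
    (pi_flat_adm : admissible (@mxD_norm R Qp abs F D n) pi_flat)
    (pi_flat_dist : distinguished (SLEstar j Nrd) pi_flat) :
  exists pi : representation R (@GL D n),
    [/\ irreducible_rep pi,
        admissible (@mxD_norm R Qp abs F D n) pi,
        distinguished (GLE j) pi
      & subrepresentation pi_flat (Res (@SL_sub_GL F D n Nrd) pi)].
Proof.
have [C normP] := nM_ring QpP D n.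
have [I [t [t' [tP cosets]]]] := GL_cosets p_prime QpP n_gt0 NrdP.
pose Z : set 'M[D]_n := [set z | exists2 a : F, a != 0 & z = (a%:A)%:M].
apply: (exists_distinguished_extension normP (GL_subgroup D n) (SL_subgroup NrdP)
          (GLE_subgroup j) _ (Z := Z) _ _ (t := t) (t' := t')) => //.
- by move=> g g' s Gg Gg' gg' _; exact: SL_normal.
- by move=> _ [a a0 ->]; exact: GLE_scal.
- by move=> _ x [a _ ->]; exact: scal_central.
- by move=> i; case: (tP i).
- by move=> i; case: (tP i).
- by move=> i; case: (tP i).
- by move=> i; case: (tP i).
- move=> g /cosets [i [a [s [a0 Ss gE]]]].
  by exists i, ((a%:A)%:M), s; split=> //; exists a.
- move=> e /(GL_near1 p_prime QpP n_gt0 NrdP) [d d0 dP]; exists d => // g Gg /(dP g Gg).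
  move=> [a [s [a0 Ss gE se]]]; exists ((a%:A)%:M), s; split=> //.
  by exists a.
Qed.
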